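(* Let $\phi:\mathcal{K}\to\mathcal{G}$ and $\psi:\mathcal{K}\to\mathcal{G}$ be morphisms of Lie groupoids. (1) If $\phi\sim_T\psi$ where $T$ is a (smooth) natural transformation, then there is a 2-morphism $H:\phi\Rightarrow\psi$ in $\mathsf{H}$. (2) If $\phi\simeq_F\psi$ where $F$ is an ordinary homotopy, then there is a 2-morphism $H:\phi\Rightarrow\psi$ in $\mathsf{H}$.
   Context: **Lie groupoids.** All groupoids are Lie groupoids: a groupoid $\mathcal{G}$ with manifolds of objects $G_0$ (Hausdorff) and arrows $G_1$, smooth structure maps, and source and target $s,t:G_1\to G_0$ submersions. The product $hg$ is defined when $s(h)=t(g)$. A morphism $\phi:\mathcal{K}\to\mathcal{G}$ is a smooth functor. A natural transformation $T$ from $\phi$ to $\psi$ (both $\mathcal{K}\to\mathcal{G}$) is a smooth map $T:K_0\to G_1$ with $T(x):\phi(x)\to\psi(x)$ and $\psi(h)T(x)=T(y)\phi(h)$ for every arrow $h:x\to y$ of $\mathcal{K}$; write $\phi\sim_T\psi$. An *ordinary homotopy* $F$ between $\phi$ and $\psi$ is a smooth functor $F:\mathcal{K}\times\mathcal{I}\to\mathcal{G}$ with $F_0=\phi$ and $F_1=\psi$, where $\mathcal{I}$ is the unit groupoid (only identity arrows) over the interval $[0,1]$; write $\phi\simeq_F\psi$. **Fundamental groupoid.** A $\mathcal{G}$-path from $x$ to $y$ over a subdivision $0=t_0\le t_1\le\cdots\le t_n=1$ is a sequence $(g_0,\alpha_1,g_1,\ldots,\alpha_n,g_n)$ with $\alpha_i:[t_{i-1},t_i]\to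 G_0$ paths and $g_i\in G_1$ arrows such that $s(g_0)=x$, $t(g_n)=y$, $s(g_i)=\alpha_i(t_i)$ for $0<i\le n$, and $t(g_i)=\alpha_{i+1}(t_i)$ for $0\le i<n$. *Equivalence* of $\mathcal{G}$-paths is generated by: (1) adding a point $s\in[t_{i-1},t_i]$ to the subdivision, replacing $\alpha_i$ by its two restrictions and inserting the identity arrow $1_{\alpha_i(s)}$; (2) for a map $h_i:[t_{i-1},t_i]\to G_1$ with $s\circ h_i=\alpha_i$, replacing $\alpha_i$ by $t\circ h_i$, $g_{i-1}$ by $h_i(t_{i-1})g_{i-1}$ and $g_i$ by $g_i(h_i(t_i))^{-1}$. A *deformation* between $(g_0,\alpha_1,\ldots,\alpha_n,g_n)$ and $(g'_0,\alpha'_1,\ldots,\alpha'_n,g'_n)$ from $x$ to $y$ over the same subdivision is given by homotopies $H_i:[t_{i-1},t_i]\times[0,1]\to G_0$ from $\alpha_i$ to $\alpha_i'$ ($1\le i\le n$) and $\gamma_i:[0,1]\to G_1$ from $g_i$ to $g'_i$ ($1\le i\le n-1$) such that $(g_0,(H_1)_s,(\gamma_1)_s,\ldots,(\gamma_{n-1})_s,(H_n)_s,g_n)$ is a $\mathcal{G}$-path for each $s\in[0,1]$ (so $g_0=g_0'$, $g_n=g_n'$). Two $\mathcal{G}$-paths are *homotopic* if related by a finite sequence of equivalences and deformations. The *fundamental groupoid* $\mathcal{G}_*=\pi_1(\mathcal{G})$ has object manifold $G_0$ and as arrows homotopy classes of $\mathcal{G}$-paths, with $[(g'_0,\alpha'_1,\ldots,g'_m)][(g_0,\alpha_1,\ldots,g_n)]=[g_0,\alpha_1,\ldots,\alpha_n,g'_0g_n,\alpha'_1,\ldots,g'_m]$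 (reparametrized). It is a Lie groupoid (Moerdijk--Mrčun), with the smooth structure for which $(s,t)$ is a local diffeomorphism, charts around an arrow $\sigma$ from $x$ to $y$ being obtained by composing $\sigma$ with short paths in contractible neighbourhoods of $x$ and $y$. A morphism $\phi:\mathcal{K}\to\mathcal{G}$ induces a morphism $\phi_*:\mathcal{K}_*\to\mathcal{G}_*$, equal to $\phi$ on objects and $\phi_*[g_0,\alpha_1,\ldots,\alpha_n,g_n]=[\phi(g_0),\phi\circ\alpha_1,\ldots,\phi\circ\alpha_n,\phi(g_n)]$. **The bicategory $\mathsf{H}$.** Objects: Lie groupoids. Morphisms: smooth functors. A 2-morphism $\phi\Rightarrow\psi$ (a strict 1-homotopy) between $\phi,\psi:\mathcal{K}\to\mathcal{G}$ is a natural transformation $\phi_*\to\psi_*$ of the induced morphisms $\mathcal{K}_*\to\mathcal{G}_*$. Horizontal and vertical compositions are those of natural transformations. *)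

(* Defs.v *)
From Stdlib Require Import Relation_Operators.
From HB Require Import structures.
From mathcomp Require Import all_boot all_order all_algebra generic_quotient.
From mathcomp Require Import all_classical all_reals all_analysis.

Set Implicit Arguments.
Unset Strict Implicit.
Unset Printing Implicit Defensive.

Import Order.TTheory GRing.Theory Num.Theory numFieldNormedType.Exports.

Local Open Scope classical_set_scope.
Local Open Scope ring_scope.
Local Open Scope quotient_scope.

(** * Manifolds and smooth maps *)

(* The coordinate map is only meaningful on the domain of the chart. *)
Record chart (R : realType) (M : Type) (n : nat) := Chart {
  chart_dom : set M;
  chart_map :> M -> 'rV[R]_n
}.

(* A set with an atlas, on which nothing is assumed yet: [is_manifold] below
   singles out the manifolds, of constant dimension [cdim].  The intermediate notion is also used for the
   interval [0,1] and for products with it, whose charts have non-open images,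
   and for the arrows of the fundamental groupoid. *)
Record charted_space (R : realType) := ChartedSpace {
  carrier :> Type;
  cdim : nat;
  atlas : set (chart R carrier cdim)
}.

Section AtlasTopology.
Context {R : realType} (M : charted_space R).

HB.instance Definition _ := gen_eqMixin (carrier M).
HB.instance Definition _ := gen_choiceMixin (carrier M).

Definition atlas_open (A : set M) :=
  forall c, atlas c -> exists2 W : set 'rV[R]_(cdim M),
    open W & chart_dom c `&` A = chart_dom c `&` c @^-1` W.

Lemma atlas_openT : atlas_open setT.
Proof. by move=> c _; exists setT; [exact: openT | rewrite preimage_setT]. Qed.

Lemma atlas_openI : setI_closed atlas_open.
Proof.
move=> A B oA oB c ac; have [W oW AW] := oA c ac; have [V oV BV] := oB c ac.
exists (W `&` V); first exact: openI.
by rewrite preimage_setI setIIr AW BV -setIIr.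
Qed.

Lemma atlas_open_bigU (I : Type) (f : I -> set M) :
  (forall i, atlas_open (f i)) -> atlas_open (\bigcup_i f i).
Proof.
move=> of_ c ac; have /choice[W WP] : forall i, exists W : set 'rV[R]_(cdim M),
    open W /\ chart_dom c `&` f i = chart_dom c `&` c @^-1` W.
  by move=> i; have [W ? ?] := of_ i c ac; exists W.
exists (\bigcup_i W i); first by apply: bigcup_open => i _; case: (WP i).
rewrite preimage_bigcup !setI_bigcupr; apply: eq_bigcupr => i _.
by case: (WP i).
Qed.

HB.instance Definition _ := isOpenTopological.Build (carrier M)
  atlas_openT atlas_openI atlas_open_bigU.

End AtlasTopology.

Fixpoint Ck (R : realType) (n m k : nat) (W : set 'rV[R]_n)
    (f : 'rV[R]_n -> 'rV[R]_m) : Prop :=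
  match k with
  | 0 => forall x, W x -> {for x, continuous f}
  | k.+1 => (forall x, W x -> differentiable f x) /\
            forall v, Ck k W (fun x => 'D_v f x)
  end.

Definition Cinf (R : realType) (n m : nat) (W : set 'rV[R]_n)
  (f : 'rV[R]_n -> 'rV[R]_m) := forall k, Ck k W f.

Section SmoothMaps.
Context {R : realType}.
Implicit Types M N : charted_space R.

(* [g] is a smooth expression of the restriction of [f] to [A], in the charts
   [c] and [d], near [x].  As [g] is defined on an open subset of the model
   space, this is smoothness by local extension when [A] is not open or when
   [c] is a chart with boundary. *)
Definition local_expr M N (A : set M) (f : M -> N) (x : M)
    (c : chart R M (cdim M)) (d : chart R N (cdim N))
    (g : 'rV[R]_(cdim M) -> 'rV[R]_(cdim N)) :=
  exists W : set 'rV[R]_(cdim M), [/\ open W, W (c x), Cinf W g &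
    forall y, A y -> chart_dom c y -> W (c y) ->
      chart_dom d (f y) /\ d (f y) = g (c y)].

Definition smooth_on M N (A : set M) (f : M -> N) :=
  forall x, A x -> exists c d, [/\ atlas c, atlas d, chart_dom c x,
    chart_dom d (f x) & exists g, local_expr A f x c d g].

Definition smooth M N (f : M -> N) := smooth_on setT f.

Definition submersion M N (f : M -> N) :=
  forall x, exists c d, [/\ atlas c, atlas d, chart_dom c x,
    chart_dom d (f x) &
    exists2 g, local_expr setT f x c d g & range ('d g (c x)) = setT].

Record is_manifold M : Prop := IsManifold {
  atlas_cover : forall x : M, exists2 c, atlas c & chart_dom c x;
  chart_inj : forall c, @atlas R M c ->
    forall x y, chart_dom c x -> chart_dom c y -> c x = c y -> x = y;
  chart_image_open : forall c, @atlas R M c -> open (c @` chart_dom c);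
  chart_compatible : forall c d, @atlas R M c -> @atlas R M d ->
    forall x, chart_dom c x -> chart_dom d x ->
    exists g, @local_expr M M setT id x c d g
}.

Definition prod_chart (M N : Type) (m n : nat) (c : chart R M m)
    (d : chart R N n) : chart R (M * N) (m + n) :=
  Chart (fun z => chart_dom c z.1 /\ chart_dom d z.2)
        (fun z => row_mx (c z.1) (d z.2)).

Definition prod_space M N : charted_space R :=
  @ChartedSpace R (M * N)%type (cdim M + cdim N)
    [set e | exists c d, [/\ atlas c, atlas d & e = prod_chart c d]].

Definition unit_interval := {u : R | 0 <= u <= 1}.

Definition interval_space : charted_space R :=
  @ChartedSpace R unit_interval 1
    [set Chart setT (fun u : unit_interval => const_mx (sval u))].

Lemma smooth_continuous M N (f : M -> N) :
  is_manifold M -> smooth f -> continuous f.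
Proof.
move=> mM sf; apply/continuousP => A oA.
have {}oA : atlas_open A by [].
suff : atlas_open (f @^-1` A) by [].
move=> c ac.
pose good (W : set 'rV[R]_(cdim M)) : Prop := open W /\
  (forall y, chart_dom c y -> W (c y) -> A (f y)).
exists (\bigcup_(W in good) W); first by apply: bigcup_open => W [].
apply/seteqP; split => [x [cx Afx]|x [cx [W [_ WA] Wx]]]; last first.
  by split => //; exact: WA.
split => //=.
have [c' [d [ac' ad c'x dfx [g [W [oW Wx sg Wg]]]]]] := sf x I.
have [e [W' [oW' W'x se W'e]]] := chart_compatible mM ac ac' cx c'x.
have [V oV AV] := oA d ad.
have e_x : c' x = e (c x) by have [] := W'e x I cx W'x.
have VgO : nbhs (e (c x)) (W `&` g @^-1` V).
  apply: filterI; first by rewrite -e_x; exact: open_nbhs_nbhs.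
  rewrite -e_x; have /= cg := sg 0%N (c' x) Wx.
  apply: cg; apply: open_nbhs_nbhs; split => //.
  have [_ <-] := Wg x I c'x Wx.
  have : (chart_dom d `&` A) (f x) by [].
  by rewrite AV => -[].
have ce := se 0%N (c x) W'x.
have : nbhs (c x) (W' `&` e @^-1` (W `&` g @^-1` V)).
  by apply: filterI; [exact: open_nbhs_nbhs | exact: ce].
rewrite nbhsE /= => -[U [oU Ux] UV]; exists U => //; split => // y cy Uy.
have [W'y [Wy Vy]] := UV _ Uy.
have [/= c'y ey] := W'e y I cy W'y.
rewrite -ey in Wy Vy.
have [dfy gy] := Wg y I c'y Wy.
have : (chart_dom d `&` d @^-1` V) (f y) by split => //=; rewrite gy.
by rewrite -AV => -[].
Qed.

End SmoothMaps.

(** * Lie groupoids *)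

(* The structure maps only; the axioms are in [is_lie_groupoid]. *)
Record groupoid_data (R : realType) := GroupoidData {
  Ob : charted_space R;
  Ar : charted_space R;
  src : Ar -> Ob;
  tgt : Ar -> Ob;
  (* [gmul h g] is the product hg, only meaningful when [src h = tgt g] *)
  gmul : Ar -> Ar -> Ar;
  gunit : Ob -> Ar;
  ginv : Ar -> Ar
}.

Record is_lie_groupoid (R : realType) (G : groupoid_data R) : Prop :=
  IsLieGroupoid {
  ob_manifold : is_manifold (Ob G);
  ob_hausdorff : hausdorff_space (Ob G);
  ar_manifold : is_manifold (Ar G);
  src_submersion : submersion (@src R G);
  tgt_submersion : submersion (@tgt R G);
  src_smooth : smooth (@src R G);
  tgt_smooth : smooth (@tgt R G);
  gunit_smooth : smooth (@gunit R G);
  ginv_smooth : smooth (@ginv R G);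
  gmul_smooth : @smooth_on R (prod_space (Ar G) (Ar G)) (Ar G)
    [set z | src z.1 = tgt z.2] (fun z => gmul z.1 z.2);
  src_unit : forall x : Ob G, src (gunit x) = x;
  tgt_unit : forall x : Ob G, tgt (gunit x) = x;
  src_inv : forall g : Ar G, src (ginv g) = tgt g;
  tgt_inv : forall g : Ar G, tgt (ginv g) = src g;
  src_mul : forall h g : Ar G, src h = tgt g -> src (gmul h g) = src g;
  tgt_mul : forall h g : Ar G, src h = tgt g -> tgt (gmul h g) = tgt h;
  gmulA : forall k h g : Ar G, src k = tgt h -> src h = tgt g ->
    gmul k (gmul h g) = gmul (gmul k h) g;
  gmul1 : forall g : Ar G, gmul g (gunit (src g)) = g;
  gmul1l : forall g : Ar G, gmul (gunit (tgt g)) g = g;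
  gmulV : forall g : Ar G, gmul g (ginv g) = gunit (tgt g);
  gmulVl : forall g : Ar G, gmul (ginv g) g = gunit (src g)
}.

Record lie_groupoid (R : realType) := LieGroupoid {
  lie_data :> groupoid_data R;
  lieP : is_lie_groupoid lie_data
}.

Record groupoid_map (R : realType) (K G : groupoid_data R) := GroupoidMap {
  fob : Ob K -> Ob G;
  far : Ar K -> Ar G
}.

Record is_morphism (R : realType) (K G : groupoid_data R)
    (f : groupoid_map K G) : Prop := IsMorphism {
  fob_smooth : smooth (fob f);
  far_smooth : smooth (far f);
  src_far : forall h, src (far f h) = fob f (src h);
  tgt_far : forall h, tgt (far f h) = fob f (tgt h);
  far_unit : forall x, far f (gunit x) = gunit (fob f x);
  far_mul : forall h g : Ar K, src h = tgt g ->
    far f (gmul h g) = gmul (far f h) (far f g)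
}.

Record morphism (R : realType) (K G : groupoid_data R) := Morphism {
  mor_map :> groupoid_map K G;
  morP : is_morphism mor_map
}.

Record nat_trans (R : realType) (K G : groupoid_data R)
    (f g : groupoid_map K G) (T : Ob K -> Ar G) : Prop := NatTrans {
  nat_smooth : smooth T;
  nat_src : forall x, src (T x) = fob f x;
  nat_tgt : forall x, tgt (T x) = fob g x;
  nat_comm : forall h : Ar K,
    gmul (far g h) (T (src h)) = gmul (T (tgt h)) (far f h)
}.

Definition prod_groupoid (R : realType) (K L : groupoid_data R) :
    groupoid_data R :=
  @GroupoidData R (prod_space (Ob K) (Ob L)) (prod_space (Ar K) (Ar L))
    (fun z => (src z.1, src z.2)) (fun z => (tgt z.1, tgt z.2))
    (fun z w => (gmul z.1 w.1, gmul z.2 w.2))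
    (fun z => (gunit z.1, gunit z.2))
    (fun z => (ginv z.1, ginv z.2)).

Definition unit_groupoid (R : realType) (M : charted_space R) :
    groupoid_data R :=
  @GroupoidData R M M id id (fun h _ => h) id id.

Definition time0 (R : realType) : @unit_interval R.
Proof. by exists 0; rewrite lexx ler01. Defined.

Definition time1 (R : realType) : @unit_interval R.
Proof. by exists 1; rewrite lexx ler01. Defined.

Record ordinary_homotopy (R : realType) (K G : groupoid_data R)
    (f g : groupoid_map K G)
    (F : morphism (prod_groupoid K (unit_groupoid interval_space)) G) : Prop :=
  OrdinaryHomotopy {
  homotopy_ob0 : forall x, fob F (x, time0 R) = fob f x;
  homotopy_ar0 : forall h, far F (h, time0 R) = far f h;
  homotopy_ob1 : forall x, fob F (x, time1 R) = fob g x;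
  homotopy_ar1 : forall h, far F (h, time1 R) = far g h
}.

(** * Groupoid paths *)

(* [Step g0 a1 t1 (... (Step gn-1 an tn (End gn)))] stands for the sequence
   (g0, a1, g1, ..., an, gn) over the subdivision 0 <= t1 <= ... <= tn; the
   starting time 0 is not recorded.  A path on [t_{i-1}, t_i] is represented by
   a function on the whole line, whose values outside of this interval are
   irrelevant. *)
Inductive gseq (R A B : Type) :=
| End of A
| Step of A & B & R & gseq R A B.

Section GSeq.
Context {R A B : Type}.

Definition first_arrow (p : gseq R A B) : A :=
  match p with End g => g | Step g _ _ _ => g end.

Fixpoint last_arrow (p : gseq R A B) : A :=
  match p with End g => g | Step _ _ _ p' => last_arrow p' end.

Definition map_first (f : A -> A) (p : gseq R A B) : gseq R A B :=
  match p with
  | End g => End _ _ (f g)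
  | Step g a t p' => Step (f g) a t p'
  end.

End GSeq.

Fixpoint gseq_map (R A B A' B' : Type) (f : A -> A') (k : B -> B')
    (p : gseq R A B) : gseq R A' B' :=
  match p with
  | End g => End _ _ (f g)
  | Step g a t p' => Step (f g) (k a) t (gseq_map f k p')
  end.

Section GPaths.
Context {R : realType} (G : groupoid_data R).

Notation I01 := (`[0, 1]%classic : set R).
Notation raw_path := (gseq R (Ar G) (R -> Ob G)).

(* [is_gpath u v x y p]: [p] is a path from [x] to [y] on the time interval
   [u, v]. *)
Fixpoint is_gpath (u v : R) (x y : Ob G) (p : raw_path) : Prop :=
  match p with
  | End g => [/\ src g = x, tgt g = y & u = v]
  | Step g a t p' => [/\ src g = x, tgt g = a u, u <= t,
      {within `[u, t], continuous a} & is_gpath t v (a t) y p']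
  end.

Record gpath := GPath {
  gval :> raw_path;
  gpathP : is_gpath 0 1 (src (first_arrow gval)) (tgt (last_arrow gval)) gval
}.

Inductive path_equiv : R -> raw_path -> raw_path -> Prop :=
| PathSubdivide u g a t p s : u <= s <= t ->
    path_equiv u (Step g a t p) (Step g a s (Step (gunit (a s)) a t p))
| PathTranslate u g a t p (h : R -> Ar G) :
    {within `[u, t], continuous h} ->
    (forall s, s \in `[u, t] -> src (h s) = a s) ->
    path_equiv u (Step g a t p)
      (Step (gmul (h u) g) (@tgt R G \o h) t
            (map_first (fun g' => gmul g' (ginv (h t))) p))
| PathLater u g a t p q :
    path_equiv t p q -> path_equiv u (Step g a t p) (Step g a t q).

Notation raw_deformation := (gseq R (R -> Ar G) (R * R -> Ob G)).

Definition stage (D : raw_deformation) (s : R) : raw_path :=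
  gseq_map (fun g => g s) (fun H r => H (r, s)) D.

Fixpoint deformation_continuous (u : R) (D : raw_deformation) : Prop :=
  match D with
  | End g => {within I01, continuous g}
  | Step g H t D' => [/\ {within I01, continuous g},
      {within `[u, t] `*` I01, continuous H} & deformation_continuous t D']
  end.

Definition path_deformation (p q : raw_path) :=
  exists D : raw_deformation,
  [/\ deformation_continuous 0 D, stage D 0 = p, stage D 1 = q &
    forall s, s \in I01 ->
    [/\ first_arrow (stage D s) = first_arrow p,
        last_arrow (stage D s) = last_arrow p &
        is_gpath 0 1 (src (first_arrow p)) (tgt (last_arrow p)) (stage D s)]].

Definition homotopic : gpath -> gpath -> Prop :=
  clos_refl_sym_trans gpath
    (fun p q => path_equiv 0 p q \/ path_deformation p q).

Definition homotopicb (p q : gpath) : bool := `[< homotopic p q >].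

Lemma homotopicb_refl : reflexive homotopicb.
Proof. by move=> p; apply/asboolP; exact: rst_refl. Qed.

Lemma homotopicb_sym : symmetric homotopicb.
Proof. by move=> p q; apply/asboolP/asboolP => H; exact: rst_sym. Qed.

Lemma homotopicb_trans : transitive homotopicb.
Proof.
move=> q p r /asboolP pq /asboolP qr; apply/asboolP; exact: rst_trans pq qr.
Qed.

HB.instance Definition _ := gen_eqMixin gpath.
HB.instance Definition _ := gen_choiceMixin gpath.

Canonical homotopic_equiv :=
  EquivRel homotopicb homotopicb_refl homotopicb_sym homotopicb_trans.

Definition path_class := {eq_quot homotopicb}.

Fixpoint rescale (c d : R) (p : raw_path) : raw_path :=
  match p with
  | End g => End _ _ g
  | Step g a t p' =>
      Step g (fun r => a ((r - d) / c)) (c * t + d) (rescale c d p')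
  end.

Fixpoint glue (p q : raw_path) : raw_path :=
  match p with
  | End g => map_first (fun g' => gmul g' g) q
  | Step g a t p' => Step g a t (glue p' q)
  end.

(* [p] on [0, 1/2] followed by [q] on [1/2, 1] *)
Definition raw_concat (p q : raw_path) : raw_path :=
  glue (rescale 2^-1 0 p) (rescale 2^-1 2^-1 q).

(* [k] builds, from the inverse of the arrow of [p] at time [u], the part of
   the reversed path which follows. *)
Fixpoint reverse_onto (u : R) (p : raw_path) (k : Ar G -> raw_path) :
    raw_path :=
  match p with
  | End g => k (ginv g)
  | Step g a t p' => reverse_onto t p'
      (fun g' => Step g' (fun r => a (1 - r)) (1 - u) (k (ginv g)))
  end.

Definition raw_reverse (p : raw_path) : raw_path :=
  reverse_onto 0 p (fun g => End _ _ g).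

Definition raw_of_path (a : R -> Ob G) : raw_path :=
  Step (gunit (a 0)) a 1 (End _ _ (gunit (a 1))).

Lemma is_gpath_ends u v x y p : is_gpath u v x y p ->
  src (first_arrow p) = x /\ tgt (last_arrow p) = y.
Proof.
elim: p u x => [g|g a t p IH] u x /=; first by case.
by case=> -> _ _ _ /IH[_ ->].
Qed.

Definition mk_gpath x y p (xpy : is_gpath 0 1 x y p) : gpath.
Proof. by exists p; have [-> ->] := is_gpath_ends xpy. Defined.

Lemma within_continuous_precomp (a : R -> Ob G) (k : R -> R) (A B : set R) :
  continuous k -> (forall r, B r -> A (k r)) ->
  {within A, continuous a} -> {within B, continuous (a \o k)}.
Proof.
move=> ck BA ca; apply/subspace_continuousP => r Br.
have /subspace_continuousP/(_ (k r) (BA _ Br)) {}ca := ca.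
move=> V /ca kV; have {}kV := ck r _ kV.
by apply: (@filterS _ (nbhs r) _ _ _ _ kV) => r' /= aV /BA; exact: aV.
Qed.

Lemma is_gpath_rescale c d u v x y p : 0 < c -> is_gpath u v x y p ->
  is_gpath (c * u + d) (c * v + d) x y (rescale c d p).
Proof.
move=> c0; have cK r : (c * r + d - d) / c = r.
  by rewrite addrK mulrC mulKf // gt_eqF.
elim: p u x => [g|g a t p IH] u x /=; first by case=> -> -> ->.
case=> -> gu ut ca /IH; rewrite !cK; split => //.
  by rewrite lerD2r ler_pM2l.
apply: (within_continuous_precomp _ _ ca) => [r|r rI].
  by apply: cvgM; [apply: cvgB; [exact: cvg_id | exact: cvg_cst] |
    exact: cvg_cst].
by rewrite /= !in_itv /= ler_pdivlMr // ler_pdivrMr // lerBrDr lerBlDr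
  ![_ * c]mulrC; move: rI; rewrite /= in_itv.
Qed.

End GPaths.

Section FundamentalGroupoid.
Context {R : realType} (G : lie_groupoid R).

Lemma is_gpath_glue u v w (x y z : Ob G) p q :
  is_gpath u v x y p -> is_gpath v w y z q -> is_gpath u w x z (glue p q).
Proof.
have LG := lieP G.
elim: p u x => [g|g a t p IH] u x /=; last first.
  by case=> gx gu ut ca pp /(IH _ _ pp).
case=> <- <- -> {u}; case: q => [g'|g' a t q] /=.
  by case=> /(fun H => H) e <- ->; rewrite (src_mul LG) // (tgt_mul LG).
by case=> e gv vt ca ?; rewrite (src_mul LG) // (tgt_mul LG).
Qed.

Lemma is_gpath_concat (x y z : Ob G) p q :
  is_gpath 0 1 x y p -> is_gpath 0 1 y z q -> is_gpath 0 1 x z (raw_concat p q).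
Proof.
have h0 : (0 : R) < 2^-1 by rewrite invr_gt0.
move=> /(is_gpath_rescale 0 h0) + /(is_gpath_rescale 2^-1 h0).
rewrite !mulr0 !mulr1 !addr0 add0r (_ : 2^-1 + 2^-1 = 1); last first.
  by rewrite [RHS](splitr 1) mul1r.
exact: is_gpath_glue.
Qed.

Lemma is_gpath_reverse_onto u v (x y z : Ob G) p k :
  is_gpath u v x y p ->
  (forall g, tgt g = x -> is_gpath (1 - u) 1 (src g) z (k g)) ->
  is_gpath (1 - v) 1 y z (reverse_onto u p k).
Proof.
have LG := lieP G.
elim: p u x k => [g|g a t p IH] u x k /=.
  by case=> gx gy <- /(_ (ginv g)); rewrite (src_inv LG) (tgt_inv LG) gy; exact.
case=> gx gu ut ca /IH {}IH kP; apply: IH => g' g't /=.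
split => //.
- by rewrite subKr.
- by rewrite lerD2l lerN2.
- apply: (within_continuous_precomp _ _ ca) => [r|r].
    by apply: cvgB; [exact: cvg_cst | exact: cvg_id].
  rewrite /= !in_itv /= => /andP[h1 h2].
  by rewrite lerBrDr lerBlDr -lerBlDl -lerBrDl h1 h2.
- have := kP (ginv g); rewrite (src_inv LG) (tgt_inv LG) subKr gu.
  exact.
Qed.

Lemma is_gpath_reverse (x y : Ob G) p :
  is_gpath 0 1 x y p -> is_gpath 0 1 y x (raw_reverse p).
Proof.
move=> xpy; have := @is_gpath_reverse_onto 0 1 x y x p (fun g => End _ _ g) xpy.
by rewrite subrr subr0; apply => g /= ->.
Qed.

Lemma is_gpath_path (a : R -> Ob G) : {within `[0, 1], continuous a} ->
  is_gpath 0 1 (a 0) (a 1) (raw_of_path a).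
Proof.
have LG := lieP G.
by move=> ca; rewrite /= !(src_unit LG) !(tgt_unit LG) ler01.
Qed.

Definition gpath_of_path (a : R -> Ob G)
  (ca : {within `[0, 1], continuous a}) : gpath G := mk_gpath (is_gpath_path ca).

Definition gpath_src (p : gpath G) : Ob G := src (first_arrow p).
Definition gpath_tgt (p : gpath G) : Ob G := tgt (last_arrow p).

(* [p] followed by [q] *)
Definition gpath_concat (p q : gpath G) (pq : gpath_src q = gpath_tgt p) :
  gpath G.
Proof.
apply: (@mk_gpath _ _ (gpath_src p) (gpath_tgt q) (raw_concat p q)).
by apply: (is_gpath_concat (gpathP p)); rewrite -/(gpath_tgt p) -pq; exact: gpathP.
Defined.

Definition gpath_reverse (p : gpath G) : gpath G :=
  mk_gpath (is_gpath_reverse (gpathP p)).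

Definition class_src (s : path_class G) : Ob G := gpath_src (repr s).
Definition class_tgt (s : path_class G) : Ob G := gpath_tgt (repr s).

(* Composition, inverse and [induced] below are computed on representatives;
   the resulting classes do not depend on them. *)
Definition class_mul (t s : path_class G) : path_class G :=
  match pselect (class_src t = class_tgt s) with
  | left e => \pi_(path_class G) (gpath_concat e)
  | right _ => t
  end.

Definition class_inv (s : path_class G) : path_class G :=
  \pi_(path_class G) (gpath_reverse (repr s)).

Definition class_of_path (a : R -> Ob G)
    (ca : {within `[0, 1], continuous a}) : path_class G :=
  \pi_(path_class G) (gpath_of_path ca).

Lemma constant_path_continuous (x : Ob G) :
  {within `[0, 1] : set R, continuous (fun _ => x)}.
Proof. by move=> r; exact: cvg_cst. Qed.

Definition class_unit (x : Ob G) : path_class G :=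
  class_of_path (@constant_path_continuous x).

Definition contractible (M : topologicalType) (U : set M) :=
  exists (x0 : M) (H : M * R -> M),
  [/\ U x0, {within U `*` `[0, 1], continuous H},
      (forall x s, U x -> s \in `[0, 1] -> U (H (x, s))),
      (forall x, U x -> H (x, 0) = x) &
      (forall x, U x -> H (x, 1) = x0)].

Definition short_path (U : set (Ob G)) (x y : Ob G) (s : path_class G) :=
  exists (a : R -> Ob G) (ca : {within `[0, 1], continuous a}),
  [/\ a 0 = x, a 1 = y, (forall r, r \in `[0, 1] -> U (a r)) &
      s = class_of_path ca].

(* The domain consists of the arrows b sigma a, with a a path in U to the source of sigma and b a
   path in V from its target.  Read in this chart and in [c] x [d], the map
   (source, target) is the identity. *)
Definition class_chart (sigma : path_class G) (U V : set (Ob G))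
    (c d : chart R (Ob G) (cdim (Ob G))) :
    chart R (path_class G) (cdim (Ob G) + cdim (Ob G)) :=
  Chart
    [set tau | exists a b : path_class G,
      [/\ short_path U (class_src tau) (class_src sigma) a,
          short_path V (class_tgt sigma) (class_tgt tau) b &
          tau = class_mul b (class_mul sigma a)]]
    (fun tau => row_mx (c (class_src tau)) (d (class_tgt tau))).

Definition contractible_nbhd (x : Ob G) (U : set (Ob G))
    (c : chart R (Ob G) (cdim (Ob G))) :=
  [/\ atlas c, open U, U x, U `<=` chart_dom c & contractible U].

Definition class_space : charted_space R :=
  @ChartedSpace R (path_class G) (cdim (Ob G) + cdim (Ob G))
    [set e | exists sigma U V c d,
      [/\ contractible_nbhd (class_src sigma) U c,
          contractible_nbhd (class_tgt sigma) V d &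
          e = class_chart sigma U V c d]].

Definition fundamental_groupoid : groupoid_data R :=
  @GroupoidData R (Ob G) class_space class_src class_tgt
    class_mul class_unit class_inv.

End FundamentalGroupoid.

Section Induced.
Context {R : realType} (K G : lie_groupoid R).

Definition raw_map (f : groupoid_map K G) :
    gseq R (Ar K) (R -> Ob K) -> gseq R (Ar G) (R -> Ob G) :=
  gseq_map (far f) (fun a => fob f \o a).

Lemma is_gpath_map (f : morphism K G) u v x y p : is_gpath u v x y p ->
  is_gpath u v (fob f x) (fob f y) (raw_map f p).
Proof.
have [sf _ fs ft _ _] := morP f.
have cf := smooth_continuous (ob_manifold (lieP K)) sf.
elim: p u x => [g|g a t p IH] u x /=.
  by case=> <- <- ->; rewrite fs ft.
case=> <- gu ut ca /IH pP; rewrite fs ft gu; split => //.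
move=> r; apply: (@continuous_comp (subspace `[u, t]) _ _ a (fob f)).
  exact: ca.
exact: cf.
Qed.

Definition gpath_map (f : morphism K G) (p : gpath K) : gpath G :=
  mk_gpath (is_gpath_map f (gpathP p)).

Definition induced (f : morphism K G) :
    groupoid_map (fundamental_groupoid K) (fundamental_groupoid G) :=
  @GroupoidMap R (fundamental_groupoid K) (fundamental_groupoid G) (fob f)
    (fun s : path_class K => \pi_(path_class G) (gpath_map f (repr s))).

(* The 2-morphisms from [f] to [g] in the bicategory H *)
Definition strict_homotopy (f g : morphism K G)
    (H : Ob (fundamental_groupoid K) -> Ar (fundamental_groupoid G)) : Prop :=
  nat_trans (induced f) (induced g) H.

End Induced.

(* Main.v *)
Require Import Defs.
From mathcomp Require Import all_boot all_order all_algebra.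
From mathcomp Require Import all_classical all_reals all_analysis.
From Stdlib Require Import Relation_Operators.
From HB Require Import structures.
From mathcomp Require Import generic_quotient.

(* The 2-morphism attached to a natural transformation T sends x to the class
   of the arrow T(x), the one attached to an ordinary homotopy F sends x to the
   class of the path F(x, -).  As every class is a product of classes of single
   arrows and of single paths, naturality has to be tested on these two kinds
   only.  There it reduces to two relations: a path h of arrows gives
   [t h] h(0) = h(1) [s h], and the two ways around the boundary of a
   continuous square of objects are homotopic.  Smoothness follows from
   naturality: if q is a short path from x to y, then
   H(y) = [psi q] H(x) [phi q]^-1, so H(y) stays in one chart around H(x), where
   H reads as y |-> (phi(y), psi(y)).

   Associativity and the other laws of the fundamental groupoid rest on the
   invariance of homotopy classes under reparametrization.  A subdivision point
   can be moved forward by letting the rest of the path wait, and by pulling the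
   waiting part back along the inverse of the arrow which precedes it. *)

Set Implicit Arguments.
Unset Strict Implicit.
Unset Printing Implicit Defensive.

Import Order.TTheory GRing.Theory Num.Theory numFieldNormedType.Exports.

Local Open Scope classical_set_scope.
Local Open Scope ring_scope.
Local Open Scope quotient_scope.

(** * Differential calculus on open sets of row vectors *)

(** The obstacle is that a deformation keeps the subdivision and the two outer arrows fixed. Sliding
    a jump in time, or absorbing a wait at either end of a path, is therefore never a deformation
    alone and needs translations. To do this once and for all, paths are compared through words,
    that is sequences of arrows and paths on [0, 1] whose times carry no meaning: two paths
    realizing one word are homotopic, and each groupoid law becomes an identity of words up to the
    removal of waits.

    Products of classes and induced morphisms are computed on chosen representatives, so every law
    is first transferred to arbitrary ones.

    Smoothness of H needs no study of the topology on homotopy classes: a chart domain containing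
    H(y) for y near x and a smooth expression in that chart are enough. As phi and psi may be smooth
    in different charts at x, this expression involves a coordinate change, whence the calculus of
    composites below. *)

Lemma near_eq_differentiable (R : numFieldType) (V W : normedModType R)
    (f g : V -> W) (x : V) :
  (\near x, f x = g x) -> differentiable f x -> differentiable g x.
Proof.
move=> fg df.
have [cdf dfE] : continuous ('d f x) /\
  f \o shift x = cst (f x) + 'd f x +o_ 0 id by apply/diff_locallyP.
have gE : g \o shift x = cst (g x) + 'd f x +o_ 0 id.
  apply/eqaddoP => _/posnumP[e].
  have /eqaddoP /(_ _ (gt0 e)) fe := dfE.
  have fg0 : \forall h \near (0 : V), f (h + x) = g (h + x).
    have := @near_shift R V 0 x (fun y => f y = g y).
    by rewrite subr0 => <-.
  near=> h; rewrite !fctE /= -(nbhs_singleton fg).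
  have -> : g (h + x) = f (h + x) by apply/esym; near: h.
  by near: h; exact: fe.
apply/diff_locallyP; have -> := diff_unique cdf gE.
by split.
Unshelve. all: by end_near. Qed.

Lemma cvg_mx (R : realType) (T : Type) (F : set_system T) (FF : Filter F) m n
    (f : T -> 'M[R]_(m, n)) (a : 'M[R]_(m, n)) :
  (forall i j, (fun t => f t i j) @ F --> a i j) -> f @ F --> a.
Proof.
move=> fa; apply/cvg_ballP => e e0.
have : \forall t \near F, forall ij : 'I_m * 'I_n,
    ball (a ij.1 ij.2) e (f t ij.1 ij.2).
  by apply: filter_forall => -[i j]; have /cvg_ballP/(_ _ e0) := fa i j.
by apply: filterS => t Ht; split=> // i j; exact: (Ht (i, j)).
Qed.

Section Ck.
Context {R : realType}.
Implicit Types (n m p k : nat).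

(** Derivatives only see values near a point and [W] is open, so the equality on [W] passes to all
    directional derivatives. *)
Lemma Ck_ext n m k (W : set 'rV[R]_n) (f g : 'rV[R]_n -> 'rV[R]_m) :
  open W -> (forall x, W x -> f x = g x) -> Ck k W f -> Ck k W g.
Proof.
move=> oW; have nW x : W x -> nbhs x W by move=> Wx; apply: open_nbhs_nbhs.
have fgn f' g' x : (forall x, W x -> f' x = g' x) -> W x ->
    nbhs x [set y | f' y = g' y].
  by move=> fg /nW; apply: (@filterS _ (nbhs x)) => y /fg.
elim: k f g => [|k IH] f g fg /=.
  move=> cf x Wx; rewrite /prop_for /continuous_at -(fg _ Wx).
  apply: cvg_trans (cf x Wx).
  exact: (@near_eq_cvg _ _ (nbhs x) _ f g (fgn _ _ _ _ fg Wx)).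
move=> [df Df]; split=> [x Wx|v].
  by apply: near_eq_differentiable (df x Wx); exact: (fgn _ _ _ _ fg Wx).
by apply: IH (Df v) => x Wx; exact/near_eq_derive/(fgn _ _ _ _ fg Wx).
Qed.

Lemma Ck_subset n m k (W V : set 'rV[R]_n) (f : 'rV[R]_n -> 'rV[R]_m) :
  V `<=` W -> Ck k W f -> Ck k V f.
Proof.
move=> VW; elim: k f => [|k IH] f /=; first by move=> cf x /VW; exact: cf.
by move=> [df Df]; split=> [x /VW|v]; [exact: df | exact: IH].
Qed.

Lemma Ck_pred n m k (W : set 'rV[R]_n) (f : 'rV[R]_n -> 'rV[R]_m) :
  Ck k.+1 W f -> Ck k W f.
Proof.
elim: k f => [|k IH] f /=.
  by move=> [df _] x Wx; exact/differentiable_continuous/df.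
by move=> [df Df]; split=> // v; exact: IH.
Qed.

Lemma Ck_cst n m k (W : set 'rV[R]_n) (a : 'rV[R]_m) : Ck k W (fun=> a).
Proof.
elim: k a => [|k IH] a /=; first by move=> x _; apply: cst_continuous.
split=> [x _|v]; first exact: differentiable_cst.
have -> : (fun x : 'rV[R]_n => 'D_v (fun=> a) x) = (fun=> 0 : 'rV[R]_m).
  by apply/funext => x; exact: (@derive_cst _ _ _ a x v).
exact: IH.
Qed.

Lemma Ck_add n m k (W : set 'rV[R]_n) (f g : 'rV[R]_n -> 'rV[R]_m) : open W ->
  Ck k W f -> Ck k W g -> Ck k W (fun x => f x + g x).
Proof.
move=> oW; elim: k f g => [|k IH] f g /=.
  by move=> cf cg x Wx; exact: (continuousD (cf x Wx) (cg x Wx)).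
move=> [df Df] [dg Dg]; split=> [x Wx|v].
  by apply: differentiableD; [exact: df | exact: dg].
apply: Ck_ext (IH _ _ (Df v) (Dg v)) => // x Wx.
by rewrite -deriveD //; apply: diff_derivable; [exact: df | exact: dg].
Qed.

Lemma Ck_sum n m k (W : set 'rV[R]_n) q (f : 'I_q -> 'rV[R]_n -> 'rV[R]_m) :
  open W -> (forall i, Ck k W (f i)) -> Ck k W (fun x => \sum_i f i x).
Proof.
move=> oW; elim: q f => [|q IH] f Cf.
  rewrite (_ : (fun _ => _) = fun=> 0); first exact: Ck_cst.
  by apply/funext => x; rewrite big_ord0.
rewrite (_ : (fun _ => _) = fun x => \sum_(i < q) f (widen_ord (leqnSn q) i) x
    + f ord_max x).
  by apply: Ck_add => //; apply: IH.
by apply/funext => x; rewrite big_ord_recr.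
Qed.

Lemma mulmxr_continuous m p (A : 'M[R]_(m, p)) :
  continuous (mulmxr A : 'rV[R]_m -> 'rV[R]_p).
Proof.
move=> x; apply: (@cvg_mx _ _ (nbhs x)) => i j.
rewrite (_ : (fun _ => _) = fun t : 'rV[R]_m => \sum_k t i k * A k j);
  last first.
  by apply/funext => t; rewrite mxE.
rewrite mxE; apply: (cvg_big (@add_continuous R) (nbhs_filter x)) => k _.
apply: (@cvgM _ _ (nbhs x)); last exact: cvg_cst.
exact: coord_continuous.
Qed.

Lemma Ck_mulmx n m p k (W : set 'rV[R]_n) (f : 'rV[R]_n -> 'rV[R]_m)
    (A : 'M[R]_(m, p)) : open W -> Ck k W f -> Ck k W (fun x => f x *m A).
Proof.
move=> oW; have cA := @mulmxr_continuous m p A.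
elim: k f => [|k IH] f /=.
  move=> cf x Wx; apply: (@continuous_comp _ _ _ f (mulmxr A)); first exact: cf.
  exact: cA.
move=> [df Df].
have dA y : differentiable (mulmxr A : 'rV[R]_m -> 'rV[R]_p) y.
  exact: linear_differentiable.
split=> [x Wx|v]; first exact: (differentiable_comp (df x Wx) (dA (f x))).
apply: Ck_ext (IH _ (Df v)) => // x Wx.
rewrite deriveE; last exact: df.
rewrite deriveE; last exact: (differentiable_comp (df x Wx) (dA (f x))).
rewrite (diff_comp (df x Wx) (dA (f x))) /=.
by rewrite (@diff_lin _ _ _ (mulmxr A)).
Qed.

(** Isolated as a bilinear map, so that the differential of a bilinear map yields the Leibniz rule
    in [Ck_scale]. *)
Definition coord_scale p m (i : 'I_p) (a : 'rV[R]_p) (b : 'rV[R]_m) :=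
    a 0 i *: b.

Lemma coord_scale_bilinear p m (i : 'I_p) : bilinear_for
  (GRing.Scale.Law.clone _ _ *:%R _) (GRing.Scale.Law.clone _ _ *:%R _)
  (@coord_scale p m i).
Proof.
split=> [u|u] a x y /=; rewrite /coord_scale.
- by rewrite !mxE scalerDl scalerA.
- by rewrite scalerDr !scalerA mulrC.
Qed.

HB.instance Definition _ p m i := bilinear_isBilinear.Build R _ _ _ _ _
  (@coord_scale p m i) (@coord_scale_bilinear p m i).

Lemma coord_scale_continuous p m i :
  continuous (fun z : 'rV[R]_p * 'rV[R]_m => coord_scale i z.1 z.2).
Proof.
move=> z; have c1 :
  {for z, continuous (fun z : 'rV[R]_p * 'rV[R]_m => z.1 0 i)}.
  apply: (@continuous_comp _ _ _ fst (fun M : 'rV[R]_p => M 0 i)).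
    exact: cvg_fst.
  exact: coord_continuous.
have c2 : {for z, continuous (@snd 'rV[R]_p 'rV[R]_m)} by exact: cvg_snd.
exact: (continuousZ c1 c2).
Qed.

Lemma Ck_scale n m p k (W : set 'rV[R]_n) (i : 'I_p)
    (f : 'rV[R]_n -> 'rV[R]_p) (g : 'rV[R]_n -> 'rV[R]_m) : open W ->
  Ck k W f -> Ck k W g -> Ck k W (fun x => f x 0 i *: g x).
Proof.
move=> oW; have cS := @coord_scale_continuous p m i.
elim: k f g => [|k IH] f g /=.
  move=> cf cg x Wx; have cfi : {for x, continuous (fun x => f x 0 i)}.
    apply: (@continuous_comp _ _ _ f (fun M : 'rV[R]_p => M 0 i)).
      exact: cf.
    exact: coord_continuous.
  exact: (continuousZ cfi (cg x Wx)).
move=> fC gC; have [[df Df] [dg Dg]] := (fC, gC).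
have dfg x : W x -> differentiable (fun x => (f x, g x)) x.
  by move=> Wx; apply: differentiable_pair; [exact: df | exact: dg].
have dC z : differentiable (fun z : 'rV[R]_p * 'rV[R]_m =>
    coord_scale i z.1 z.2) z.
  exact: (@differentiable_bilin _ _ _ _ (@coord_scale p m i)).
have dS x : W x -> differentiable (fun x => f x 0 i *: g x) x.
  by move=> Wx; exact: (differentiable_comp (dfg x Wx) (dC _)).
split=> [|v]; first exact: dS.
(* The Leibniz rule: in each summand one factor is differentiated, and the other is lowered by one
   order with [Ck_pred]. *)
apply: Ck_ext (Ck_add oW (IH _ _ (Ck_pred fC) (Dg v))
  (IH _ _ (Df v) (Ck_pred gC))) => // x Wx.
rewrite (deriveE _ (dS x Wx)) (deriveE _ (df x Wx)) (deriveE _ (dg x Wx)).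
have /(congr1 (@^~ v)) := diff_comp (dfg x Wx) (dC (f x, g x)).
rewrite [RHS]/comp (diff_pair (df x Wx) (dg x Wx)).
by rewrite (@diff_bilin _ _ _ _ (@coord_scale p m i)).
Qed.

(** The chain rule, written with partial derivatives of [g], leaves sums of products of a coordinate
    of a derivative of [f] with a composite of lower order. The induction fixes [f] and lets [g]
    vary. *)
Lemma Ck_comp n m p k (W : set 'rV[R]_n) (V : set 'rV[R]_m)
    (f : 'rV[R]_n -> 'rV[R]_m) (g : 'rV[R]_m -> 'rV[R]_p) :
  open W -> (forall x, W x -> V (f x)) -> Ck k W f -> Ck k V g ->
  Ck k W (g \o f).
Proof.
move=> oW WV; elim: k g => [|k IH] g.
  move=> cf cg x Wx; apply: (@continuous_comp _ _ _ f g); first exact: cf.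
  exact/cg/WV.
move=> fC [dg Dg]; have [df Df] := fC.
split=> [x Wx|v].
  by apply: (differentiable_comp (df x Wx) (dg _ _)); exact: WV.
pose h (i : 'I_m) x := ('D_v f x) 0 i *: 'D_(delta_mx 0 i) g (f x).
apply: (@Ck_ext _ _ _ _ (fun x => \sum_i h i x)) => // [x Wx|].
  have dgx : differentiable g (f x) by exact/dg/WV.
  rewrite deriveE; last exact: (differentiable_comp (df x Wx) dgx).
  rewrite (diff_comp (df x Wx) dgx) /= [X in _ = 'd g _ X]row_sum_delta
    linear_sum.
  apply: eq_bigr => i _; rewrite /h linearZ /= deriveE //; last exact: df.
  by rewrite [X in _ *: X]deriveE.
apply: Ck_sum => // i; apply: Ck_scale => //; first exact: Df.
exact: (IH (fun y => 'D_(delta_mx 0 i) g y) (Ck_pred fC) (Dg _)).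
Qed.

Lemma Ck_row_mx n m p k (W : set 'rV[R]_n) (f : 'rV[R]_n -> 'rV[R]_m)
    (g : 'rV[R]_n -> 'rV[R]_p) : open W ->
  Ck k W f -> Ck k W g -> Ck k W (fun x => row_mx (f x) (g x)).
Proof.
move=> oW Cf Cg.
rewrite (_ : (fun _ => _) = fun x =>
    f x *m row_mx 1%:M 0 + g x *m row_mx 0 1%:M).
  by apply: Ck_add => //; exact: Ck_mulmx.
by apply/funext => x;
  rewrite !mul_mx_row !mulmx1 !mulmx0 add_row_mx addr0 add0r.
Qed.

End Ck.

(** * Charts *)

Lemma continuous_pair_at (T U V : topologicalType) (f : T -> U) (g : T -> V)
    (x : T) : {for x, continuous f} -> {for x, continuous g} ->
  {for x, continuous (fun t => (f t, g t))}.
Proof. by move=> cf cg; exact: (cvg_pair cf cg). Qed.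

Section Charts.
Context {R : realType}.
Implicit Types M N : charted_space R.

(** Continuity tested along a filter. [smooth_continuous] asks for a manifold, whereas a cylinder
    over the interval has charts with non-open images; here convergence in the charts at [x]
    suffices. *)
Lemma smooth_on_cvg M N (A : set M) (f : M -> N) (T : Type)
    (F : set_system T) (FF : Filter F) (k : T -> M) (x : M) :
  smooth_on A f -> A x -> (\forall t \near F, A (k t)) ->
  (forall c, atlas c -> chart_dom c x ->
    (\forall t \near F, chart_dom c (k t)) /\
    (fun t => c (k t)) @ F --> c x) ->
  (fun t => f (k t)) @ F --> f x.
Proof.
move=> sf Ax Ak kx; have [c [d [ac ad cx dfx [g [W [oW Wx sg Wg]]]]]] :=
  sf x Ax.
have [ck cvk] := kx c ac cx.
move=> B; rewrite nbhsE => -[Q [oQ Qfx] QB]; rewrite /= -/(nbhs _ _).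
have {}oQ : atlas_open Q := oQ.
have [V oV QV] := oQ d ad; have [dxE dfxE] := Wg x Ax cx Wx.
have : (chart_dom d `&` Q) (f x) by [].
rewrite QV => -[_ /= Vfx].
have Vg : nbhs (c x) (g @^-1` V).
  have /= cg := sg 0%N (c x) Wx; apply: cg.
  by rewrite -dfxE; apply: open_nbhs_nbhs.
have Wc : nbhs (c x) W by apply: open_nbhs_nbhs.
have FW : F (fun t => W (c (k t))) := cvk _ Wc.
have FV : F (fun t => V (g (c (k t)))) := cvk _ Vg.
have := @filterI _ F FF _ _ (@filterI _ F FF _ _ Ak ck)
  (@filterI _ F FF _ _ FW FV).
apply: (@filterS _ F) => t [[At ct] [Wt Vt]] /=.
apply: QB; have [dft gE] := Wg _ At ct Wt.
have : (chart_dom d `&` d @^-1` V) (f (k t)) by split=> //=; rewrite gE.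
by rewrite -QV => -[].
Qed.

Lemma open_chart_preimage M (c : chart R M (cdim M)) (W : set 'rV[R]_(cdim M)) :
  is_manifold M -> atlas c -> open W -> open (chart_dom c `&` c @^-1` W).
Proof.
move=> mM ac oW; suff : atlas_open (chart_dom c `&` c @^-1` W) by [].
move=> d ad.
pose good (V : set 'rV[R]_(cdim M)) : Prop := open V /\
  (forall y, chart_dom d y -> V (d y) -> chart_dom c y /\ W (c y)).
(* Taking the union of all good sets avoids choosing a neighbourhood for each point. *)
exists (\bigcup_(V in good) V); first by apply: bigcup_open => V [].
apply/seteqP; split => [x [dx [cx Wx]]|x [dx [V [_ VW] Vx]]]; last first.
  by split => //; exact: VW.
split => //=; have [g [V [oV Vx sg Vg]]] := chart_compatible mM ad ac dx cx.
have [_ cxE] := Vg x I dx Vx.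
have : nbhs (d x) (V `&` g @^-1` W).
  apply: filterI; first by apply: open_nbhs_nbhs.
  by apply: (sg 0%N (d x) Vx); rewrite -cxE; apply: open_nbhs_nbhs.
rewrite nbhsE /= => -[U [oU Ux] UV]; exists U => //; split => // y dy Uy.
have [Vy /= Wgy] := UV _ Uy; have [/= cy cyE] := Vg y I dy Vy.
by rewrite cyE.
Qed.

Lemma open_chart_dom M (c : chart R M (cdim M)) :
  is_manifold M -> atlas c -> open (chart_dom c).
Proof.
move=> mM ac; rewrite -[chart_dom c]setIT -(preimage_setT c).
exact/open_chart_preimage/openT.
Qed.

Lemma chart_continuous M (c : chart R M (cdim M)) x :
  is_manifold M -> atlas c -> chart_dom c x -> {for x, continuous c}.
Proof.
move=> mM ac cx A; rewrite nbhsE => -[Q [oQ Qx] QA].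
rewrite /= -/(nbhs _ _);
  apply: (@filterS _ (nbhs x) _ (chart_dom c `&` c @^-1` Q)).
  by move=> y [_ /QA].
by apply: open_nbhs_nbhs; split=> //; exact: open_chart_preimage.
Qed.

(** The point [x] is the default value outside of the image of the chart. *)
Definition chart_inv M (x : M) (c : chart R M (cdim M)) (w : 'rV[R]_(cdim M)) :=
  xget x [set y | chart_dom c y /\ c y = w].

Lemma chart_invP M (x : M) (c : chart R M (cdim M)) w :
  (c @` chart_dom c) w ->
  chart_dom c (chart_inv x c w) /\ c (chart_inv x c w) = w.
Proof.
move=> [y cy yw].
by apply: (@xgetPex _ x [set y | chart_dom c y /\ c y = w]); exists y.
Qed.

Lemma chart_invK M (x : M) (c : chart R M (cdim M)) y :
  is_manifold M -> atlas c -> chart_dom c y -> chart_inv x c (c y) = y.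
Proof.
move=> mM ac cy; have [] := @chart_invP M x c (c y); first by exists y.
by move=> ? ?; exact: (chart_inj mM ac).
Qed.

Lemma chart_inv_continuous M (x : M) (c : chart R M (cdim M)) w :
  is_manifold M -> atlas c -> (c @` chart_dom c) w ->
  {for w, continuous (chart_inv x c)}.
Proof.
move=> mM ac cw A; rewrite nbhsE => -[Q [oQ Qx] QA]; rewrite /= -/(nbhs _ _).
have {}oQ : atlas_open Q := oQ.
have [V oV QV] := oQ c ac.
have [ciw cciw] := chart_invP x cw.
have Vw : V w.
  have : (chart_dom c `&` Q) (chart_inv x c w) by [].
  by rewrite QV => -[_ /=]; rewrite cciw.
apply: (@filterS _ (nbhs w) _ (V `&` c @` chart_dom c)).
  move=> v [Vv cv]; apply: QA; have [civ cciv] := chart_invP x cv.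
  have : (chart_dom c `&` c @^-1` V) (chart_inv x c v) by rewrite /= cciv.
  by rewrite -QV => -[].
by apply: open_nbhs_nbhs; split=> //; apply: openI => //;
  exact: chart_image_open.
Qed.

Lemma conv_continuous (V : normedModType R) :
  continuous (fun z : (V * V) * R => (1 - z.2) *: z.1.1 + z.2 *: z.1.2).
Proof.
move=> z; apply: (@cvgD _ _ _ (nbhs z)).
  apply: (@cvgZ _ _ _ (nbhs z)).
    by apply: (@cvgB _ _ _ (nbhs z)); [exact: cvg_cst | exact: cvg_snd].
  by apply: (cvg_comp fst fst); exact: cvg_fst.
apply: (@cvgZ _ _ _ (nbhs z)); first exact: cvg_snd.
by apply: (cvg_comp fst snd); [exact: cvg_fst | exact: cvg_snd].
Qed.

Lemma ball_conv (V : normedModType R) (x y z : V) e s :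
  s \in `[0, 1] -> ball x e y -> ball x e z ->
  ball x e ((1 - s) *: y + s *: z).
Proof.
rewrite in_itv /= -!ball_normE /ball_ /= => /andP[s0 s1] xy xz.
have -> : x - ((1 - s) *: y + s *: z) = (1 - s) *: (x - y) + s *: (x - z).
  rewrite !scalerBr addrACA -scalerDl subrK scale1r opprD; congr (_ + _).
apply: le_lt_trans (ler_normD _ _) _; rewrite !normrZ.
rewrite ger0_norm ?subr_ge0 // ger0_norm //.
apply: (@le_lt_trans _ _ (Num.max `|x - y| `|x - z|)); last first.
  by rewrite gt_max xy xz.
set m := Num.max _ _; have mE : m = (1 - s) * m + s * m.
  by rewrite -mulrDl subrK mul1r.
rewrite [leRHS]mE /m lerD //; apply: ler_wpM2l => //.
- by rewrite subr_ge0.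
- by rewrite le_max lexx.
- by rewrite le_max lexx orbT.
Qed.

(** A ball in the chart is convex, so it is contracted to its centre along segments. *)
Lemma contractible_nbhd_exists (G : lie_groupoid R) (x : Ob G)
    (c : chart R (Ob G) (cdim (Ob G))) :
  atlas c -> chart_dom c x -> exists U, contractible_nbhd x U c.
Proof.
move=> ac cx; have mM := ob_manifold (lieP G).
have /nbhs_ballP[e e0 eI] : nbhs (c x) (c @` chart_dom c).
  by apply: open_nbhs_nbhs; split; [exact: chart_image_open | exists x].
exists (chart_dom c `&` c @^-1` ball (c x) e); split=> //.
- by apply: open_chart_preimage => //; exact: ball_open.
- by split=> //; exact: ballxx.
- exists x, (fun z => chart_inv x c ((1 - z.2) *: c z.1 + z.2 *: c x)).
  have im y s : chart_dom c y -> ball (c x) e (c y) -> s \in `[0, 1] ->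
      ball (c x) e ((1 - s) *: c y + s *: c x).
    by move=> cy ey s01; apply: ball_conv => //; exact: ballxx.
  split.
  + by split=> //; exact: ballxx.
  + apply/subspace_continuousP => -[y s] [[cy ey] s01].
    apply: cvg_within_filter.
    have s01' : s \in `[0, 1] by [].
    apply: (@continuous_comp _ _ _
      (fun z : Ob G * R => (1 - z.2) *: c z.1 + z.2 *: c x) (chart_inv x c)).
      apply: (@continuous_comp _ _ _ (fun z : Ob G * R => ((c z.1, c x), z.2))
        (fun z => (1 - z.2) *: z.1.1 + z.2 *: z.1.2)); last first.
        exact: conv_continuous.
      apply: (@continuous_pair_at _ _ _ (fun z => (c z.1, c x)) snd);
        last exact: cvg_snd.
      apply: (@continuous_pair_at _ _ _ (c \o fst) (fun=> c x));
        last exact: cvg_cst.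
      apply: (@continuous_comp _ _ _ fst c); first exact: cvg_fst.
      exact: chart_continuous.
    by apply: chart_inv_continuous => //; exact/eI/im.
  + move=> y s [cy ey] s01; have /eI/(chart_invP x) := im _ _ cy ey s01.
    by move=> [h1 h2]; split => //=; rewrite h2; exact: im.
  + by move=> y [cy ey] /=; rewrite subr0 scale1r scale0r addr0 chart_invK.
  + by move=> y [cy ey] /=; rewrite subrr scale1r scale0r add0r chart_invK.
Qed.

(** This provides the short paths, as segments in the chart. The nearby endpoints are given by an
    open set [B] of coordinates, the form in which [local_expr] asks for a neighbourhood. *)
Lemma straight_path M (x : M) (c : chart R M (cdim M)) (Q : set M) :
  is_manifold M -> atlas c -> chart_dom c x -> nbhs x Q ->
  exists B : set 'rV[R]_(cdim M), [/\ open B, B (c x) &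
    forall y, chart_dom c y -> B (c y) -> exists q : R -> M,
      [/\ {within `[0, 1], continuous q}, q 0 = x, q 1 = y &
        forall r, r \in `[0, 1] -> Q (q r)]].
Proof.
move=> mM ac cx xQ.
(* The radius keeps the ball inside the image of the chart, and makes the inverse chart send it into
   [Q]. *)
have /nbhs_ballP[e e0 eI] : nbhs (c x)
  (c @` chart_dom c `&` chart_inv x c @^-1` Q).
  apply: filterI.
    by apply: open_nbhs_nbhs; split; [exact: chart_image_open | exists x].
  have cc : {for c x, continuous (chart_inv x c)}.
    by apply: chart_inv_continuous => //; exists x.
  by apply: cc; rewrite chart_invK.
exists (ball (c x) e); split; [exact: ball_open | exact: ballxx |].
move=> y cy ey; exists (fun r => chart_inv x c ((1 - r) *: c x + r *: c y)).
have im s : s \in `[0, 1] -> ball (c x) e ((1 - s) *: c x + s *: c y).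
  by move=> s01; apply: ball_conv => //; exact: ballxx.
split.
- apply/subspace_continuousP => s s01; apply: cvg_within_filter.
  apply: (@continuous_comp _ _ _
    (fun s : R => (1 - s) *: c x + s *: c y) (chart_inv x c)).
    apply: (@continuous_comp _ _ _ (fun s : R => ((c x, c y), s))
        (fun z => (1 - z.2) *: z.1.1 + z.2 *: z.1.2)); last first.
      exact: conv_continuous.
    apply: (@continuous_pair_at _ _ _ (fun=> (c x, c y)) id);
      last exact: cvg_id.
    exact: cvg_cst.
  by apply: chart_inv_continuous => //; have /im/eI[] : s \in `[0, 1] by [].
- by rewrite subr0 scale1r scale0r addr0 chart_invK.
- by rewrite subrr scale1r scale0r add0r chart_invK.
- by move=> r /im/eI[].
Qed.

(** Paths are functions on the whole line, while an ordinary homotopy lives over [unit_interval];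
    this retraction turns its slices into such functions. *)
Definition clamp (r : R) : @unit_interval R.
Proof.
exists (Num.max 0 (Num.min r 1)).
by rewrite le_max lexx /= ge_max ler01 ge_min lexx orbT.
Defined.

Lemma clamp_continuous : continuous (fun r : R => Num.max 0 (Num.min r 1)).
Proof.
apply: (@max_fun_continuous _ R R (fun=> 0) (fun r => Num.min r 1)).
  by move=> r; exact: cvg_cst.
apply: (@min_fun_continuous _ R R id (fun=> 1)) => r; first exact: cvg_id.
exact: cvg_cst.
Qed.

(** The filter is arbitrary because the lemma serves both for slices of the cylinder and for points
    that converge only within the unit square. *)
Lemma smooth_cylinder_cvg M N (f : prod_space M interval_space -> N) (T : Type)
    (F : set_system T) (FF : Filter F) (k : T -> M) (s : T -> R) (x : M) (r : R)
        :
  is_manifold M -> smooth f -> k @ F --> x -> s @ F --> r ->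
  (fun t => f (k t, clamp (s t))) @ F --> f (x, clamp r).
Proof.
move=> mM sf kx sr.
apply: (@smooth_on_cvg (prod_space M interval_space) N setT f T F FF
  (fun t => (k t, clamp (s t)) : prod_space M interval_space)
  (x, clamp r)) => //.
  exact: filterE.
move=> _ [c [d [ac -> ->]]] [/= cx _]; split.
  have := kx _ (open_nbhs_nbhs (conj (open_chart_dom mM ac) cx)).
  by apply: (@filterS _ F) => t ct; split.
have ck : (fun t => c (k t)) @ F --> c x.
  by move=> B /(chart_continuous mM ac cx)/kx.
have ms : (fun t => Num.max 0 (Num.min (s t) 1)) @ F -->
  Num.max 0 (Num.min r 1).
  by move=> B /clamp_continuous/sr.
apply: (@cvg_mx _ _ F) => i j; rewrite !mxE.
rewrite (_ : (fun _ => _) = fun t => match fintype.split j with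
  inl j => c (k t) i j | inr j => Num.max 0 (Num.min (s t) 1) end); last first.
  by apply/funext => t; rewrite mxE; case: fintype.split => // ?; rewrite mxE.
case: fintype.split => j'; rewrite ?mxE //.
by move=> B /coord_continuous/ck.
Qed.

End Charts.

(** * Homotopy of groupoid paths on arbitrary time intervals *)

Section GSeqMap.
Context {R A B A' B' A'' B'' : Type}.

Lemma gseq_map_comp (f : A -> A') (k : B -> B') (f' : A' -> A'')
    (k' : B' -> B'')
    (p : gseq R A B) :
  gseq_map f' k' (gseq_map f k p) = gseq_map (f' \o f) (k' \o k) p.
Proof. by elim: p => //= g a t p ->. Qed.

Lemma gseq_map_id (p : gseq R A B) : gseq_map id id p = p.
Proof. by elim: p => //= g a t p ->. Qed.

Lemma first_arrow_map (f : A -> A') (k : B -> B') (p : gseq R A B) :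
  first_arrow (gseq_map f k p) = f (first_arrow p).
Proof. by case: p. Qed.

Lemma last_arrow_map (f : A -> A') (k : B -> B') (p : gseq R A B) :
  last_arrow (gseq_map f k p) = f (last_arrow p).
Proof. by elim: p. Qed.

Lemma map_first_id (f : A -> A) (p : gseq R A B) :
  f (first_arrow p) = first_arrow p -> map_first f p = p.
Proof. by case: p => [g|g a t p] /= ->. Qed.

Lemma map_first_comp (f g h : A -> A) (p : gseq R A B) :
  f (g (first_arrow p)) = h (first_arrow p) ->
  map_first f (map_first g p) = map_first h p.
Proof. by case: p => [k|k a t p] /= ->. Qed.

Lemma first_arrow_map_first (f : A -> A) (p : gseq R A B) :
  first_arrow (map_first f p) = f (first_arrow p).
Proof. by case: p. Qed.

End GSeqMap.

Section Homotopy.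
Context {R : realType} (G : lie_groupoid R).
Let LG := lieP G.

Notation I01 := (`[0, 1]%classic : set R).
Notation raw_path := (gseq R (Ar G) (R -> Ob G)).
Notation raw_deformation := (gseq R (R -> Ar G) (R * R -> Ob G)).
Implicit Types (u v t : R) (x y z : Ob G) (p q : raw_path) (g : Ar G).

Lemma continuous_src : continuous (@src R G).
Proof. exact: (smooth_continuous (ar_manifold LG) (src_smooth LG)). Qed.

Lemma continuous_tgt : continuous (@tgt R G).
Proof. exact: (smooth_continuous (ar_manifold LG) (tgt_smooth LG)). Qed.

Lemma continuous_gunit : continuous (@gunit R G).
Proof. exact: (smooth_continuous (ob_manifold LG) (gunit_smooth LG)). Qed.

Lemma ginv_unit x : ginv (gunit x) = gunit x :> Ar G.
Proof.
have := gmul1l LG (ginv (gunit x)).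
by rewrite (tgt_inv LG) (src_unit LG) (gmulV LG) (tgt_unit LG).
Qed.

Lemma ginvK g : ginv (ginv g) = g.
Proof.
have e1 := tgt_inv LG g; have e2 := src_inv LG g.
rewrite -[LHS](gmul1 LG) (src_inv LG) e1 -(gmulVl LG) (gmulA LG) //; last first.
  by rewrite (src_inv LG).
by rewrite (gmulVl LG) e2 (gmul1l LG).
Qed.

Lemma within_continuous_postcomp (S T U : topologicalType) (A : set S)
    (f : S -> T)
    (k : T -> U) : {within A, continuous f} -> continuous k ->
  {within A, continuous (k \o f)}.
Proof.
move=> cf ck r; apply: (@continuous_comp (subspace A) _ _ f k); first exact: cf.
exact: ck.
Qed.

Lemma within_continuous_comp_within (S T U : topologicalType) (A : set S)
    (B : set T) (f : S -> T) (k : T -> U) :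
  {within A, continuous f} -> (forall s, A s -> B (f s)) ->
  {within B, continuous k} -> {within A, continuous (k \o f)}.
Proof.
move=> cf AB ck; apply/subspace_continuousP => s As.
have /subspace_continuousP/(_ s As) {}cf := cf.
have /subspace_continuousP/(_ (f s) (AB s As)) {}ck := ck.
move=> V /ck/cf sV; apply: (@filterS _ (nbhs s) _ _ _ _ sV).
by move=> s' /= h As'; exact: (h As' (AB _ As')).
Qed.

Lemma within_continuous_fst (S T U : topologicalType) (A : set S) (B : set T)
    (f : S -> U) :
  {within A, continuous f} -> {within A `*` B, continuous (f \o fst)}.
Proof.
apply: within_continuous_comp_within => [|s []//].
by apply: continuous_subspaceT => s; exact: cvg_fst.
Qed.

Lemma within_continuous_eq (S T : topologicalType) (A : set S) (f k : S -> T) :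
  (forall s, A s -> f s = k s) -> {within A, continuous f} ->
  {within A, continuous k}.
Proof.
by move=> fk; apply: subspace_eq_continuous => s; rewrite inE; exact: fk.
Qed.

Lemma within_continuous_cat (T : topologicalType) (f : R -> T) u t v :
  {within `[u, t], continuous f} -> {within `[t, v], continuous f} ->
  {within `[u, v], continuous f}.
Proof.
move=> cf1 cf2; apply: (@continuous_subspaceW _ _ _ (`[u, t] `|` `[t, v])).
  move=> s /=; rewrite !in_itv /= => /andP[us sv].
  by have [st|/ltW ts] := leP s t; [left|right]; apply/andP.
by apply: withinU_continuous => //; exact: itv_closed.
Qed.

Lemma is_gpath_map_first u v x x' y p (f : Ar G -> Ar G) :
  is_gpath u v x y p ->
  src (f (first_arrow p)) = x' ->
    tgt (f (first_arrow p)) = tgt (first_arrow p) ->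
  is_gpath u v x' y (map_first f p).
Proof.
case: p => [g|g a t p] /=; first by case=> _ <- -> -> ->.
by case=> _ ga ut ca pp -> ->; rewrite ga.
Qed.

Lemma path_equiv_gpath u v x y p q : path_equiv u p q ->
  is_gpath u v x y p -> is_gpath u v x y q.
Proof.
move=> pq; elim: pq x => {u p q}.
- move=> u g a t p s /andP[us st] x /= [gx ga ut ca pp].
  rewrite (src_unit LG) (tgt_unit LG); split => //.
    by apply: continuous_subspaceW ca => r /=; rewrite !in_itv /= =>
      /andP[-> /le_trans->].
  split => //.
  apply: continuous_subspaceW ca => r /=; rewrite !in_itv /= => /andP[+ ->].
  by move=> /(le_trans us) ->.
- move=> u g a t p h ch sh x /= [gx ga ut ca pp].
  have hu : src (h u) = tgt g by rewrite ga sh // bound_itvE.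
  have ht : src (h t) = a t by rewrite sh // bound_itvE.
  rewrite (src_mul LG) // (tgt_mul LG) //; split => //.
    exact/within_continuous_postcomp/continuous_tgt.
  have [pf _] := is_gpath_ends pp.
  apply: (is_gpath_map_first pp).
    by rewrite (src_mul LG) ?(src_inv LG) ?(tgt_inv LG) ?ht.
  by rewrite (tgt_mul LG) ?(tgt_inv LG) ?ht.
- move=> u g a t p q _ IH x /= [gx ga ut ca pp]; split => //; exact: IH.
Qed.

(** Inductions along a path reach its tails, which start at later times and at other objects; hence
    the interval and the ends are parameters. *)
Definition path_deformation_on u v x y p q :=
  exists D : raw_deformation,
  [/\ deformation_continuous u D, stage D 0 = p, stage D 1 = q &
    forall s, s \in I01 ->
    [/\ first_arrow (stage D s) = first_arrow p,
        last_arrow (stage D s) = last_arrow p &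
        is_gpath u v x y (stage D s)]].

(** Raw sequences need not be paths, so the validity of both sides is built into the relation; every
    intermediate term of a chain between two distinct paths is then a path. *)
Definition elementary_homotopy u v x y p q :=
  [/\ is_gpath u v x y p, is_gpath u v x y q &
    path_equiv u p q \/ path_deformation_on u v x y p q].

Definition homotopic_on u v x y : raw_path -> raw_path -> Prop :=
  clos_refl_sym_trans _ (elementary_homotopy u v x y).

Lemma homotopic_on_refl u v x y p : homotopic_on u v x y p p.
Proof. exact: rst_refl. Qed.

Lemma homotopic_on_sym u v x y p q :
  homotopic_on u v x y p q -> homotopic_on u v x y q p.
Proof. exact: rst_sym. Qed.

Lemma homotopic_on_trans u v x y q p r :
  homotopic_on u v x y p q -> homotopic_on u v x y q r ->
  homotopic_on u v x y p r.
Proof. exact: rst_trans. Qed.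

Lemma homotopic_on_gpath u v x y p q : homotopic_on u v x y p q ->
  is_gpath u v x y p <-> is_gpath u v x y q.
Proof.
elim=> {p q} [p q [hp hq _]||p q _ IH|p q r _ IH1 _ IH2] //.
- by split; apply IH.
- exact: (iff_trans IH1 IH2).
Qed.

Lemma homotopic_on_congr u v x y u' v' x' y' (C : raw_path -> raw_path) p q :
  (forall p q, elementary_homotopy u v x y p q ->
     homotopic_on u' v' x' y' (C p) (C q)) ->
  homotopic_on u v x y p q -> homotopic_on u' v' x' y' (C p) (C q).
Proof.
move=> CP; elim=> {p q} [p q|p|p q _ IH|p q r _ IH1 _ IH2].
- exact: CP.
- exact: homotopic_on_refl.
- exact: homotopic_on_sym.
- exact: (homotopic_on_trans IH1 IH2).
Qed.

Lemma path_equiv_homotopic_on u v x y p q : is_gpath u v x y p ->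
  path_equiv u p q -> homotopic_on u v x y p q.
Proof.
by move=> hp pq; apply: rst_step; split; [|exact: path_equiv_gpath pq hp|left].
Qed.

Lemma homotopic_on_Step u v x y g a t p q :
  src g = x -> tgt g = a u -> u <= t -> {within `[u, t], continuous a} ->
  homotopic_on t v (a t) y p q ->
  homotopic_on u v x y (Step g a t p) (Step g a t q).
Proof.
move=> gx ga ut ca; apply: homotopic_on_congr => {}p {}q [hp hq pq].
apply: rst_step; split => //; case: pq => [pq|[D [cD D0 D1 Ds]]].
  by left; exact: PathLater.
right; exists (Step (fun=> g) (a \o fst) t D); split => /=.
- split => //; first by move=> s; exact: cvg_cst.
  exact: within_continuous_fst.
- by rewrite -D0; congr Step.
- by rewrite -D1; congr Step.
- by move=> s sI; have [? ? ?] := Ds s sI; split.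
Qed.

(** Functions which agree on [u, t] may differ elsewhere; they are exchanged by translating along
    the identity arrows of [b]. *)
Lemma homotopic_on_eq u v x y g (a b : R -> Ob G) t p :
  is_gpath u v x y (Step g a t p) -> (forall s, s \in `[u, t] -> a s = b s) ->
  homotopic_on u v x y (Step g a t p) (Step g b t p).
Proof.
move=> hp ab; have [gx ga ut ca pp] := hp.
have cb : {within `[u, t], continuous b}.
  exact: within_continuous_eq ca.
have := @PathTranslate R G u g a t p (fun s => gunit (b s))
  (within_continuous_postcomp cb continuous_gunit).
rewrite (_ : @tgt R G \o _ = b); last first.
  by apply/funext => s /=; rewrite (tgt_unit LG).
rewrite -ab ?bound_itvE // -ga (gmul1l LG) map_first_id; last first.
  have [pa _] := is_gpath_ends pp.
  by rewrite -ab ?bound_itvE // ginv_unit -pa (gmul1 LG).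
move=> E; apply: path_equiv_homotopic_on => //; apply: E => s sI.
by rewrite (src_unit LG) ab.
Qed.

Lemma homotopic_on_translate u v x y g (a : R -> Ob G) t p k :
  is_gpath u v x y (Step g a t p) ->
  (forall s, s \in `[u, t] -> a s = src k) ->
  homotopic_on u v x y (Step g a t p) (Step (gmul k g) (fun=> tgt k) t
    (map_first (fun g' => gmul g' (ginv k)) p)).
Proof.
move=> hp ak; apply: path_equiv_homotopic_on => //.
apply: (@PathTranslate R G u g a t p (fun=> k)) => [r|s sI];
  first exact: cvg_cst.
by rewrite ak.
Qed.

(** The inverse of a subdivision. Subdividing [c] gives two copies of [c], which [homotopic_on_eq]
    then replaces by [a] and [b]. *)
Lemma homotopic_on_merge u v x y g (a b c : R -> Ob G) t t' p :
  is_gpath u v x y (Step g a t (Step (gunit (a t)) b t' p)) ->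
  (forall s, s \in `[u, t] -> c s = a s) ->
  (forall s, s \in `[t, t'] -> c s = b s) ->
  homotopic_on u v x y (Step g a t (Step (gunit (a t)) b t' p)) (Step g c t' p).
Proof.
move=> /= hp ca cb; have [gx ga ut cta [_ + tt' ctb pp]] := hp.
rewrite (tgt_unit LG) => atb.
have cct : {within `[u, t], continuous c}.
  by apply: within_continuous_eq cta => s sI; rewrite ca.
have cct' : {within `[t, t'], continuous c}.
  by apply: within_continuous_eq ctb => s sI; rewrite cb.
have ct : c t = a t by rewrite ca ?bound_itvE.
have cu : c u = a u by rewrite ca ?bound_itvE.
have ct' : c t' = b t' by rewrite cb ?bound_itvE.
have hc : is_gpath u v x y (Step g c t' p).
  split => //; [by rewrite cu|exact: le_trans tt'| |by rewrite ct'].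
  exact: within_continuous_cat cct cct'.
apply: homotopic_on_sym.
apply: homotopic_on_trans (path_equiv_homotopic_on hc (PathSubdivide g c p _))
  _.
  by apply/andP; split; [exact: ut | exact: tt'].
have hc' : is_gpath u v x y (Step g c t (Step (gunit (c t)) c t' p)).
  by rewrite /= (src_unit LG) (tgt_unit LG) cu ct'; split => //; split.
apply: homotopic_on_trans (homotopic_on_eq hc' ca) _.
rewrite ct; apply: homotopic_on_Step => //.
apply: homotopic_on_eq => //=; rewrite (src_unit LG) (tgt_unit LG) ct'.
by split=> //; rewrite ct.
Qed.

Definition constant_deformation p : raw_deformation :=
  gseq_map (fun g => fun=> g) (fun a => a \o fst) p.

Lemma stage_constant_deformation p s : stage (constant_deformation p) s = p.
Proof. by rewrite /stage gseq_map_comp -[RHS]gseq_map_id. Qed.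

Lemma constant_deformation_continuous u v x y p :
  is_gpath u v x y p -> deformation_continuous u (constant_deformation p).
Proof.
elim: p u x => [g|g a t p IH] u x /=; first by move=> _ s; exact: cvg_cst.
case=> _ _ _ ca /IH; split=> //; first by move=> s; exact: cvg_cst.
exact: within_continuous_fst.
Qed.

Lemma homotopic_on_deform u v x y g t p (H : R * R -> Ob G) :
  is_gpath u v x y (Step g (fun r => H (r, 0)) t p) ->
  {within `[u, t] `*` I01, continuous H} ->
  (forall s, s \in I01 -> H (u, s) = H (u, 0) /\ H (t, s) = H (t, 0)) ->
  homotopic_on u v x y (Step g (fun r => H (r, 0)) t p)
    (Step g (fun r => H (r, 1)) t p).
Proof.
move=> hp cH Hends; have /= [gx ga ut ca pp] := hp.
have hs s : s \in I01 -> is_gpath u v x y (Step g (fun r => H (r, s)) t p).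
  move=> sI; have [Hu Ht] := Hends s sI; rewrite /= Hu Ht; split => //.
  apply: (@within_continuous_comp_within _ _ _ _ (`[u, t] `*` I01)
    (fun r => (r, s)) H) cH; last by move=> r rI; split => //;
        rewrite inE in sI.
  apply: continuous_subspaceT => r.
  by apply: continuous_pair_at; [exact: cvg_id | exact: cvg_cst].
have I0 : 0 \in I01 by rewrite inE /= bound_itvE.
have I1 : 1 \in I01 by rewrite inE /= bound_itvE.
apply: rst_step; split; [exact: hs | exact: hs | right].
exists (Step (fun=> g) H t (constant_deformation p)); split => /=.
- split => //; first by move=> s; exact: cvg_cst.
  exact: constant_deformation_continuous pp.
- by rewrite /stage /= -/(stage _ _) stage_constant_deformation.
- by rewrite /stage /= -/(stage _ _) stage_constant_deformation.
- by move=> s /hs; rewrite /stage /= -/(stage _ _) stage_constant_deformation.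
Qed.

(** The stages of [H] agree with [a] and [b] on [u, t] only, hence the corrections by
    [homotopic_on_eq] at both ends. *)
Lemma homotopic_on_deform_step u v x y g a b t p (H : R * R -> Ob G) :
  is_gpath u v x y (Step g a t p) ->
  {within `[u, t] `*` I01, continuous H} ->
  (forall r, r \in `[u, t] -> H (r, 0) = a r /\ H (r, 1) = b r) ->
  (forall s, s \in `[0, 1] -> H (u, s) = a u /\ H (t, s) = a t) ->
  homotopic_on u v x y (Step g a t p) (Step g b t p).
Proof.
move=> hp cH Hab Hends; have /= [gx ga ut ca pp] := hp.
have h1 : homotopic_on u v x y (Step g a t p) (Step g (fun r => H (r, 0)) t p).
  by apply: homotopic_on_eq => // r /Hab[].
have g1 := (homotopic_on_gpath h1).1 hp.
apply: (homotopic_on_trans h1).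
have h2 : homotopic_on u v x y (Step g (fun r => H (r, 0)) t p)
    (Step g (fun r => H (r, 1)) t p).
  apply: homotopic_on_deform => // s; rewrite inE => /Hends[-> ->].
  by have [-> ->] : H (u, 0) = a u /\ H (t, 0) = a t by apply: Hends;
    rewrite bound_itvE.
apply: (homotopic_on_trans h2); have g2 := (homotopic_on_gpath h2).1 g1.
by apply: homotopic_on_eq => // r /Hab[].
Qed.

(* A jump can be delayed if the path stays constant after it: the constant part
   is translated back by the inverse of the jump. *)
Lemma homotopic_on_delay u v x y g g1 (a b : R -> Ob G) t t' t1 p :
  is_gpath u v x y (Step g a t (Step g1 b t1 p)) -> t <= t' <= t1 ->
  (forall s, s \in `[t, t'] -> b s = tgt g1) ->
  homotopic_on u v x y (Step g a t (Step g1 b t1 p))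
    (Step g (fun s => a (Num.min s t)) t' (Step g1 b t1 p)).
Proof.
move=> hp tt1 bc; have /= [gx ga ut ca [g1a g1b tt1' cb pp]] := hp.
have /andP[tt' t't1] := tt1.
set p1 := Step g1 b t1 p; have hp1 : is_gpath t v (a t) y p1 by split.
have bt' : b t' = tgt g1 by apply: bc; rewrite bound_itvE.
pose q1 := Step (gunit (b t')) b t1 p.
(* Cut at t', up to which the path is still waiting at the target of [g1]. *)
have e1 : homotopic_on t v (a t) y p1 (Step g1 b t' q1).
  by apply: path_equiv_homotopic_on => //; exact: PathSubdivide.
have hq1 := (homotopic_on_gpath e1).1 hp1.
pose k := ginv g1.
have e2 : homotopic_on t v (a t) y (Step g1 b t' q1)
    (Step (gunit (a t)) (fun=> a t) t' p1).
  have E : Step (gmul k g1) (fun=> tgt k) t'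
      (map_first (fun g' => gmul g' (ginv k)) q1) =
      Step (gunit (a t)) (fun=> a t) t' p1.
    by rewrite /k (gmulVl LG) (tgt_inv LG) g1a /= ginvK bt' (gmul1l LG).
  rewrite -E; apply: homotopic_on_translate => // s sI.
  by rewrite bc // (src_inv LG).
have e3 : homotopic_on u v x y (Step g a t p1)
  (Step g a t (Step (gunit (a t)) (fun=> a t) t' p1)).
  by apply: homotopic_on_Step => //; exact: homotopic_on_trans e1 e2.
apply: (homotopic_on_trans e3); apply: homotopic_on_merge.
- exact: (homotopic_on_gpath e3).1.
- by move=> s; rewrite in_itv /= => /andP[_ st]; rewrite min_l.
- by move=> s; rewrite in_itv /= => /andP[ts _]; rewrite min_r.
Qed.

End Homotopy.

(** * Reparametrization *)

Section Reparametrization.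
Context {R : realType} (G : lie_groupoid R).
Let LG := lieP G.

Notation I01 := (`[0, 1]%classic : set R).
Notation raw_path := (gseq R (Ar G) (R -> Ob G)).
Implicit Types (u v t : R) (x y z : Ob G) (p q w : raw_path) (g : Ar G).

(* [a] runs through [A] between the times [u] and [t].  A constant [A] is
   allowed to be run through in no time. *)
Definition runs_through (A : R -> Ob G) u t (a : R -> Ob G) :=
  {within I01, continuous A} /\ exists l : R -> R,
  [/\ continuous l,
    forall s, s \in `[u, t] -> l s \in `[0, 1] /\ a s = A (l s) &
    (l u = 0 /\ l t = 1) \/ (forall s, s \in `[0, 1] -> A s = A 0)].

(* The times of [w] are irrelevant, and its paths are defined on [0, 1]. *)
Fixpoint realizes u w p : Prop :=
  match w, p with
  | End g, End g' => g = g'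
  | Step g A _ w, Step g' a t p =>
      [/\ g = g', runs_through A u t a & realizes t w p]
  | _, _ => False
  end.

Lemma runs_through_ends A u t a : u <= t -> runs_through A u t a ->
  a u = A 0 /\ a t = A 1.
Proof.
move=> ut [_ [l [_ la lends]]].
have [lu ->] : l u \in `[0, 1] /\ a u = A (l u) by apply: la;
  rewrite bound_itvE.
have [lt ->] : l t \in `[0, 1] /\ a t = A (l t) by apply: la;
  rewrite bound_itvE.
case: lends => [[-> ->//]|Ac]; rewrite !Ac //.
by rewrite bound_itvE ler01.
Qed.

Lemma itv_conv (r r' s : R) : r \in `[0, 1] -> r' \in `[0, 1] ->
  s \in `[0, 1] -> (1 - s) * r + s * r' \in `[0, 1].
Proof.
rewrite !in_itv /= => /andP[r0 r1] /andP[r'0 r'1] /andP[s0 s1].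
have s1' : 0 <= 1 - s by rewrite subr_ge0.
apply/andP; split; first by rewrite addr_ge0 // mulr_ge0.
rewrite -[leRHS](subrK s) lerD //; first by rewrite ler_piMr.
by rewrite ler_piMr.
Qed.

Lemma interpolation_continuous (k l : R -> R) : continuous k -> continuous l ->
  continuous (fun z : R * R => (1 - z.2) * k z.1 + z.2 * l z.1).
Proof.
move=> ck cl z; have cf (m : R -> R) : continuous m ->
    {for z, continuous (m \o @fst R R)}.
  by move=> cm; apply: continuous_comp; [exact: cvg_fst | exact: cm].
apply: (@cvgD _ _ _ (nbhs z)); apply: (@cvgM _ _ (nbhs z)).
- by apply: (@cvgB _ _ _ (nbhs z)); [exact: cvg_cst | exact: cvg_snd].
- exact: cf.
- exact: cvg_snd.
- exact: cf.
Qed.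

(** The parametrizations [l] and [m] are joined by linear interpolation. The ends stay fixed because
    both parametrizations go from 0 to 1, or else because [A] is constant. *)
Lemma runs_through_homotopic u v x y g A a b t p :
  is_gpath u v x y (Step g a t p) -> u <= t ->
  runs_through A u t a -> runs_through A u t b ->
  homotopic_on u v x y (Step g a t p) (Step g b t p).
Proof.
move=> hp ut Aa Ab; have [ua ta] := runs_through_ends ut Aa.
have [cA [l [cl la lends]]] := Aa; have [_ [m [cm mb mends]]] := Ab.
pose H := A \o (fun z : R * R => (1 - z.2) * l z.1 + z.2 * m z.1).
apply: (@homotopic_on_deform_step _ _ _ _ _ _ _ _ _ _ _ H) => //.
- apply: (within_continuous_comp_within _ _ cA); last first.
    move=> [r s] /= [rI sI]; apply: itv_conv => //.
      by have [] := la r rI.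
    by have [] := mb r rI.
  by apply: continuous_subspaceT; exact: interpolation_continuous.
- move=> r rI; rewrite /H /= subr0 subrr !mul1r !mul0r addr0 add0r.
  by have [_ ->] := la r rI; have [_ ->] := mb r rI.
- move=> s sI; rewrite /H /= ua ta.
  have [Ac|[-> -> -> ->]] : (forall s, s \in `[0, 1] -> A s = A 0) \/
      [/\ l u = 0, l t = 1, m u = 0 & m t = 1].
    case: lends => [[? ?]|?]; last by left.
    by case: mends => [[? ?]|?]; [right | left].
    rewrite [A 1]Ac ?bound_itvE // !Ac //; apply: itv_conv => //.
    + by have [] := la t; rewrite ?bound_itvE.
    + by have [] := mb t; rewrite ?bound_itvE.
    + by have [] := la u; rewrite ?bound_itvE.
    + by have [] := mb u; rewrite ?bound_itvE.
  by rewrite !mulr0 !mulr1 add0r subrK.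
Qed.

Lemma continuous_minl (t : R) : continuous (fun s : R => Num.min s t).
Proof.
by apply: (@min_fun_continuous _ R R id (fun=> t)) => r;
  [exact: cvg_id|exact: cvg_cst].
Qed.

Lemma continuous_maxl (t : R) : continuous (fun s : R => Num.max s t).
Proof.
by apply: (@max_fun_continuous _ R R id (fun=> t)) => r;
  [exact: cvg_id|exact: cvg_cst].
Qed.

(** With [Num.min] the path waits at its end, and with [Num.max] in the next lemma at its
    beginning. *)
Lemma runs_through_minl A u t t' a : u <= t <= t' -> runs_through A u t a ->
  runs_through A u t' (fun s => a (Num.min s t)).
Proof.
move=> /andP[ut tt'] [cA [l [cl la lends]]]; split=> //.
exists (fun s => l (Num.min s t)); split.
- by move=> s; apply: continuous_comp; [exact: continuous_minl | exact: cl].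
- move=> s; rewrite in_itv /= => /andP[us st']; apply: la.
  by rewrite in_itv /= le_min us ut ge_min lexx orbT.
- by rewrite min_l // min_r.
Qed.

Lemma runs_through_maxl A u t t' a : u <= t <= t' -> runs_through A t t' a ->
  runs_through A u t' (fun s => a (Num.max s t)).
Proof.
move=> /andP[ut tt'] [cA [l [cl la lends]]]; split=> //.
exists (fun s => l (Num.max s t)); split.
- by move=> s; apply: continuous_comp; [exact: continuous_maxl | exact: cl].
- move=> s; rewrite in_itv /= => /andP[us st']; apply: la.
  by rewrite in_itv /= le_max ge_max lexx orbT st' tt'.
- by rewrite max_r // max_l.
Qed.

(** The two paths differ only in their times and parametrizations. If the first break of [p] comes
    before that of [q], the induction hypothesis replaces the rest of [p] by a wait followed by the
    rest of [q], and [homotopic_on_delay] then moves the break. *)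
Lemma realizes_homotopic w u v x y p q :
  is_gpath u v x y p -> is_gpath u v x y q ->
  realizes u w p -> realizes u w q -> homotopic_on u v x y p q.
Proof.
elim: w u x p q => [g|g A s0 w IH] u x p q; case: p => [g'|g' a t p] //;
  case: q => [g''|g'' b t' q] //=.
  by move=> _ _ <- <-; exact: homotopic_on_refl.
move=> hp hq [ggp Aa wp] [ggq Ab wq].
subst g' g''; move: hp hq.
wlog tt' : a b t t' p q Aa Ab wp wq / t <= t'.
  move=> H hp hq; have [?|/ltW ?] := leP t t'; first exact: H.
  by apply: homotopic_on_sym; exact: H.
move=> hp hq; have [gx ga ut ca pp] := hp; have [_ gb ut' cb qq] := hq.
have [au at1] := runs_through_ends ut Aa; have [bu bt1] :=
  runs_through_ends ut' Ab.
move: tt'; rewrite le_eqVlt => /orP[/eqP tt'|tt'].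
  subst t'.
  apply: (homotopic_on_trans (runs_through_homotopic hp ut Aa Ab)).
  apply: homotopic_on_Step => //; apply: IH => //.
  by rewrite bt1 -at1.
(* If the word has no further path, both breaks are at time [v], against t < t'. *)
case: q wq hq qq => [g1|g1 b1 t1 q].
  case: w IH wp => //= g0 _; case: p pp hp => //= ? [_ _ tv] _ _ _ _ [_ _ t'v].
  by move: tt'; rewrite tv t'v ltxx.
case: w IH wp => // g0 A1 t0 w IH;
  case: p pp hp => // g1' a1 t1' p pp hp wp wq hq qq.
have /= [ggp Aa1 wp'] := wp; have /= [ggq Ab1 wq'] := wq.
have /= [g1b g1b1 t't1 cb1 qq1] := qq.
(* The path [r] makes the jump [g1] already at time t, waits at its target until t', and goes on
   like [q]. *)
pose b2 s := b1 (Num.max s t').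
pose r := Step g1 b2 t1 q.
have b2t1 : b2 t1 = b1 t1 by rewrite /b2 max_l.
have tt't1 : t <= t' <= t1 by rewrite (ltW tt').
have hr : is_gpath t v (a t) y r.
  split.
  - by rewrite g1b bt1 at1.
  - by rewrite /b2 max_r // ltW.
  - exact: le_trans (ltW tt') t't1.
  - apply: within_continuous_comp_within cb1.
      exact/continuous_subspaceT/continuous_maxl.
    move=> s /=; rewrite !in_itv /= => /andP[ts st1].
    by rewrite le_max ge_max lexx orbT st1 t't1.
  - by rewrite b2t1.
have wr : realizes t (Step g0 A1 t0 w) r.
  by split => //; exact: runs_through_maxl.
have e1 : homotopic_on u v x y (Step g a t (Step g1' a1 t1' p)) (Step g a t r).
  by apply: homotopic_on_Step => //; exact: IH.
apply: (homotopic_on_trans e1).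
have hr1 := (homotopic_on_gpath e1).1 hp.
have e2 : homotopic_on u v x y (Step g a t r)
    (Step g (fun s => a (Num.min s t)) t' r).
  apply: homotopic_on_delay => // s; rewrite in_itv /= => /andP[ts st'].
  by rewrite /b2 max_r.
apply: (homotopic_on_trans e2); have hr2 := (homotopic_on_gpath e2).1 hr1.
have Aa' : runs_through A u t' (fun s => a (Num.min s t)).
  by apply: runs_through_minl => //; rewrite ut ltW.
have e3 : homotopic_on u v x y (Step g (fun s => a (Num.min s t)) t' r)
    (Step g b t' r).
  exact: runs_through_homotopic Aa' Ab.
apply: (homotopic_on_trans e3); have [_ _ _ _ hr3] :=
  (homotopic_on_gpath e3).1 hr2.
apply: homotopic_on_Step => //; apply: homotopic_on_eq => // s.
by rewrite in_itv /= => /andP[t's _]; rewrite /b2 max_l.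
Qed.

Lemma affine_inv_continuous (c d : R) : continuous (fun r : R => (r - d) / c).
Proof.
move=> r; apply: (@cvgM _ _ (nbhs r)); last exact: cvg_cst.
by apply: (@cvgB _ _ _ (nbhs r)); [exact: cvg_id | exact: cvg_cst].
Qed.

Lemma affine_inv_itv (c d u t r : R) : 0 < c ->
  (r \in `[c * u + d, c * t + d]) = ((r - d) / c \in `[u, t]).
Proof.
move=> c0; rewrite !in_itv /= ler_pdivlMr // ler_pdivrMr // lerBrDr lerBlDr.
by rewrite ![_ * c]mulrC.
Qed.

Lemma realizes_rescale c d u w p : 0 < c -> realizes u w p ->
  realizes (c * u + d) w (rescale c d p).
Proof.
move=> c0; elim: w u p => [g|g A t0 w IH] u [g'|g' a t p] //=.
case=> <- [cA [l [cl la lends]]] /IH wp; split=> //; split=> //.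
have cK r : (c * r + d - d) / c = r by rewrite addrK mulrC mulKf // gt_eqF.
exists (fun r => l ((r - d) / c)); split.
- move=> r; apply: (@continuous_comp _ _ _ (fun r => (r - d) / c) l).
    exact: affine_inv_continuous.
  exact: cl.
- by move=> r; rewrite affine_inv_itv //; exact: la.
- by rewrite !cK.
Qed.

Lemma first_arrow_realizes u w p : realizes u w p ->
    first_arrow w = first_arrow p.
Proof. by case: w p => [g|g A ? w] [g'|g' a t p] //= []. Qed.

Lemma last_arrow_realizes u w p : realizes u w p -> last_arrow w = last_arrow p.
Proof.
elim: w u p => [g|g A ? w IH] u [g'|g' a t p] //= [_ _]; exact: IH.
Qed.

Lemma realizes_glue u v x y w w' p q : is_gpath u v x y p ->
  realizes u w p -> realizes v w' q ->
    realizes u (Defs.glue w w') (Defs.glue p q).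
Proof.
elim: w u x p => [g|g A ? w IH] u x [g'|g' a t p] //=.
  case=> _ _ -> ->; case: w' q => [k|k B ? w'] [k'|k' b t q] //=.
    by move=> ->.
  by case=> ->.
by case=> _ _ _ _ pp [-> Aa wp] wq; split=> //; exact: (IH _ _ _ pp wp wq).
Qed.

(** The affine change of time stays meaningful on an interval of length zero, where it gives a
    constant path. *)
Fixpoint word_of u p : raw_path :=
  match p with
  | End g => End _ _ g
  | Step g a t p => Step g (fun s => a (u + s * (t - u))) t (word_of t p)
  end.

Lemma word_of_realizes u v x y p : is_gpath u v x y p ->
    realizes u (word_of u p) p.
Proof.
elim: p u x => [g|g a t p IH] u x //= [_ _ ut ca /IH pp]; split=> //.
have cA : continuous (fun s : R => u + s * (t - u)).
  move=> s; apply: (@cvgD _ _ _ (nbhs s)); first exact: cvg_cst.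
  by apply: (@cvgM _ _ (nbhs s)); [exact: cvg_id | exact: cvg_cst].
split.
  apply: within_continuous_comp_within ca; first exact: continuous_subspaceT.
  move=> s /=; rewrite !in_itv /= => /andP[s0 s1]; apply/andP; split.
    by rewrite lerDl mulr_ge0 // subr_ge0.
  by rewrite addrC -lerBrDr ler_piMl // subr_ge0.
(* For u = t the path of the word is constant, the second alternative in [runs_through]; otherwise
   the affine map is inverted. *)
move: ut; rewrite le_eqVlt => /orP[/eqP->|ut].
  exists (fun=> 0); split.
  - by move=> s; exact: cvg_cst.
  - move=> s; rewrite in_itv /= -eq_le => /eqP <-; rewrite bound_itvE ler01.
    by rewrite mul0r addr0.
  - by right => s _; rewrite subrr !mulr0.
have tu0 : 0 < t - u by rewrite subr_gt0.
exists (fun r => (r - u) / (t - u)); split.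
- exact: affine_inv_continuous.
- move=> s; rewrite !in_itv /= => /andP[us st]; split.
    apply/andP; split; first by rewrite divr_ge0 // ?subr_ge0 // ltW.
    by rewrite ler_pdivrMr // mul1r lerD2r.
  by rewrite divfK ?gt_eqF // addrC subrK.
- by left; rewrite subrr mul0r divff // gt_eqF.
Qed.

End Reparametrization.

(** * Compatibility of homotopy with concatenation and morphisms *)

Section Congruence.
Context {R : realType} (G : lie_groupoid R).
Let LG := lieP G.

Notation I01 := (`[0, 1]%classic : set R).
Notation raw_path := (gseq R (Ar G) (R -> Ob G)).
Notation raw_deformation := (gseq R (R -> Ar G) (R * R -> Ob G)).
Implicit Types (u v t : R) (x y z : Ob G) (p q : raw_path) (g : Ar G)
  (D : raw_deformation).

Lemma first_arrow_rescale c d p :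
  first_arrow (rescale c d p) = first_arrow p.
Proof. by case: p. Qed.

Lemma last_arrow_rescale c d p : last_arrow (rescale c d p) = last_arrow p.
Proof. by elim: p. Qed.

Lemma rescale_map_first c d (f : Ar G -> Ar G) p :
  rescale c d (map_first f p) = map_first f (rescale c d p).
Proof. by case: p. Qed.

Lemma path_equiv_rescale c d u p q : 0 < c -> path_equiv u p q ->
  path_equiv (c * u + d) (rescale c d p) (rescale c d q).
Proof.
move=> c0; have cK r : (c * r + d - d) / c = r.
  by rewrite addrK mulrC mulKf // gt_eqF.
elim=> {u p q} /=.
- move=> u g a t p s /andP[us st].
  have := @PathSubdivide R G (c * u + d) g (fun r => a ((r - d) / c))
    (c * t + d)
    (rescale c d p) (c * s + d).
  by rewrite cK; apply; rewrite !lerD2r !ler_pM2l // us.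
- move=> u g a t p h ch sh.
  have := @PathTranslate R G (c * u + d) g (fun r => a ((r - d) / c))
    (c * t + d)
    (rescale c d p) (fun r => h ((r - d) / c)).
  rewrite !cK rescale_map_first; apply.
    apply: (within_continuous_comp_within _ _ ch).
      exact/continuous_subspaceT/affine_inv_continuous.
    by move=> r /=; rewrite affine_inv_itv.
  by move=> s; rewrite affine_inv_itv //; exact: sh.
- by move=> u g a t p q _ IH; exact: PathLater.
Qed.

Fixpoint rescale_deformation (c d : R) D : raw_deformation :=
  match D with
  | End g => End _ _ g
  | Step g H t D => Step g (fun r => H ((r.1 - d) / c, r.2)) (c * t + d)
      (rescale_deformation c d D)
  end.

Lemma stage_rescale c d D s :
  stage (rescale_deformation c d D) s = rescale c d (stage D s).
Proof. by rewrite /stage; elim: D => //= g H t D ->. Qed.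

Lemma rescale_deformation_continuous c d u D : 0 < c ->
  deformation_continuous u D ->
  deformation_continuous (c * u + d) (rescale_deformation c d D).
Proof.
move=> c0; elim: D u => [g|g H t D IH] u //= [cg cH /IH cD]; split=> //.
apply: (within_continuous_comp_within _ _ cH); last first.
  by move=> [r s] /= [rI sI]; split => //=; rewrite -affine_inv_itv.
apply: continuous_subspaceT => r.
apply: (@continuous_pair_at _ _ _ (fun r : R * R => (r.1 - d) / c) snd);
  last first.
  exact: cvg_snd.
apply: (@continuous_comp _ _ _ fst (fun r : R => (r - d) / c)).
  exact: cvg_fst.
exact: affine_inv_continuous.
Qed.

Lemma homotopic_on_rescale c d u v x y p q : 0 < c ->
  homotopic_on u v x y p q ->
  homotopic_on (c * u + d) (c * v + d) x y (rescale c d p) (rescale c d q).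
Proof.
move=> c0; apply: homotopic_on_congr => {}p {}q [hp hq pq].
apply: rst_step; split; [exact: is_gpath_rescale|exact: is_gpath_rescale|].
case: pq => [pq|[D [cD D0 D1 Ds]]]; first by left; exact: path_equiv_rescale.
right; exists (rescale_deformation c d D); split.
- exact: rescale_deformation_continuous.
- by rewrite stage_rescale D0.
- by rewrite stage_rescale D1.
- move=> s sI; have [fs ls gs] := Ds s sI; rewrite stage_rescale.
  rewrite !first_arrow_rescale !last_arrow_rescale fs ls; split=> //.
  exact: is_gpath_rescale.
Qed.

Lemma path_equiv_map_first u v x y g p q : tgt g = x -> is_gpath u v x y p ->
  path_equiv u p q ->
  path_equiv u (map_first (fun k => gmul k g) p)
    (map_first (fun k => gmul k g) q).
Proof.
move=> gx hp pq; case: pq hp => {u p q} /=.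
- by move=> u g' a t p s us _; exact: PathSubdivide.
- move=> u g' a t p h ch sh [g'x g'a ut ca pp].
  rewrite -(gmulA LG); [exact: PathTranslate|rewrite sh ?bound_itvE //|].
    by rewrite g'x gx.
- by move=> u g' a t p q pq _; exact: PathLater.
Qed.

Lemma is_gpath_premul u v x y z g p : is_gpath u v x y p -> tgt g = x ->
  src g = z -> is_gpath u v z y (map_first (fun k => gmul k g) p).
Proof.
by move=> hp gx gz; apply: (@is_gpath_glue R G u u v z x y (End _ _ g)).
Qed.

Lemma stage_map_first (f : Ar G -> Ar G) D g s :
  first_arrow (stage D s) = g ->
  stage (map_first (fun _ => fun=> f g) D) s = map_first f (stage D s).
Proof. by case: D => [k|k H t D] /= ->. Qed.

Lemma homotopic_on_premul u v x y z g p q : tgt g = x -> src g = z ->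
  homotopic_on u v x y p q ->
  homotopic_on u v z y (map_first (fun k => gmul k g) p)
    (map_first (fun k => gmul k g) q).
Proof.
move=> gx gz; apply: homotopic_on_congr => {}p {}q [hp hq pq].
apply: rst_step; split;
  [exact: is_gpath_premul hp _ _|exact: is_gpath_premul hq _ _|].
case: pq => [pq|[D [cD D0 D1 Ds]]]; first by left;
  exact: path_equiv_map_first hp pq.
right; set f := fun k => gmul k g.
have I0 : 0 \in I01 by rewrite inE /= bound_itvE.
have I1 : 1 \in I01 by rewrite inE /= bound_itvE.
(* The first arrow does not move during a deformation, so its product with [g] is a constant family
   and its continuity is immediate. *)
exists (map_first (fun _ => fun=> f (first_arrow p)) D); split.
- case: D cD {D0 D1 Ds} => [k|k H t D] /=; first by move=> _ s; exact: cvg_cst.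
  by case=> _ cH cD; split=> // s; exact: cvg_cst.
- by rewrite (stage_map_first f) ?D0 //; have [] := Ds 0 I0; rewrite D0.
- by rewrite (stage_map_first f) ?D1 //; have [] := Ds 1 I1; rewrite D1.
- move=> s sI; have [fs ls gs] := Ds s sI.
  rewrite (stage_map_first f) // !first_arrow_map_first fs; split=> //.
  + by move: ls; rewrite -D0; case: (D) => [k|k H t D'] //= ->.
  + exact: is_gpath_premul gs _ _.
Qed.

Lemma homotopic_on_glue_r u v w x y z p q q' : is_gpath u v x y p ->
  homotopic_on v w y z q q' ->
  homotopic_on u w x z (Defs.glue p q) (Defs.glue p q').
Proof.
elim: p u x => [g|g a t p IH] u x /= hp qq'.
  by case: hp => gx gy ->; exact: homotopic_on_premul qq'.
by case: hp => gx ga ut ca pp; apply: homotopic_on_Step => //; exact: IH.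
Qed.

Lemma glue_map_first f p q :
  Defs.glue (map_first f p) q =
  match p with End g => map_first (fun k => gmul k (f g)) q
  | Step g a t p => Step (f g) a t (Defs.glue p q) end.
Proof. by case: p. Qed.

Lemma path_equiv_glue u v w x y z p p' q : is_gpath u v x y p ->
  is_gpath v w y z q ->
  path_equiv u p p' -> path_equiv u (Defs.glue p q) (Defs.glue p' q).
Proof.
move=> + hq pp'; elim: pp' x => {u p p'} /=.
- by move=> u g a t p s us _ _; exact: PathSubdivide.
- move=> u g a t p h ch sh x [gx ga ut ca pp].
  have := @PathTranslate R G u g a t (Defs.glue p q) h ch sh.
  rewrite glue_map_first; case: p pp => [g'|g' a' t' p] //= [g'a g'y tv].
  have ht : src (h t) = a t by rewrite sh // bound_itvE.
  (* Here the translation touches the last arrow of the first path, which gluing multiplies into the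
     first arrow of [q]; associativity compares the two orders. *)
  rewrite (@map_first_comp _ _ _ _ _ (fun k => gmul k (gmul g' (ginv (h t)))))
    //.
  have [qy _] := is_gpath_ends hq.
  by rewrite (gmulA LG) ?(tgt_inv LG) ?ht // g'y.
- move=> u g a t p p' _ IH x [gx ga ut ca pp]; apply: PathLater; apply: IH pp.
Qed.

(** The argument [g] stands for the last arrow of the stages of [D], which a deformation keeps
    fixed; this makes the glued part constant. *)
Fixpoint glue_deformation D q g : raw_deformation :=
  match D with
  | End _ => constant_deformation (map_first (fun k => gmul k g) q)
  | Step k H t D => Step k H t (glue_deformation D q g)
  end.

Lemma stage_glue_deformation D q g s : last_arrow (stage D s) = g ->
  stage (glue_deformation D q g) s = Defs.glue (stage D s) q.
Proof.
elim: D => [k|k H t D IH] /=; first by move=> ->;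
  rewrite stage_constant_deformation.
by move=> /IH; rewrite /stage /= => ->.
Qed.

Lemma glue_deformation_continuous D q g s u v w x y z :
  is_gpath u v x y (stage D s) -> is_gpath v w y z q ->
  last_arrow (stage D s) = g ->
  deformation_continuous u D ->
    deformation_continuous u (glue_deformation D q g).
Proof.
move=> + hq; elim: D u x => [k|k H t D IH] u x /=.
  move=> [ks kt ->] kg _; apply: constant_deformation_continuous.
  by apply: is_gpath_premul hq _ _; rewrite -kg.
by move=> [_ _ _ _ hD] Dg [ck cH cD]; split => //; apply: IH hD Dg cD.
Qed.

Lemma first_arrow_glue p q : first_arrow (Defs.glue p q) =
  match p with End g => gmul (first_arrow q) g | Step g _ _ _ => g end.
Proof. by case: p => //= g; rewrite first_arrow_map_first. Qed.

Lemma last_arrow_glue p q : last_arrow (Defs.glue p q) =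
  match q with End g => gmul g (last_arrow p) | _ => last_arrow q end.
Proof. by elim: p => [g|g a t p IH] //=; case: q. Qed.

Lemma homotopic_on_glue_l u v w x y z p p' q : is_gpath v w y z q ->
  homotopic_on u v x y p p' ->
  homotopic_on u w x z (Defs.glue p q) (Defs.glue p' q).
Proof.
move=> hq; apply: (homotopic_on_congr (C := fun p => Defs.glue p q)) =>
  {}p {}p' [hp hp' pp'].
apply: rst_step; split;
  [exact: (is_gpath_glue hp hq)|exact: (is_gpath_glue hp' hq)|].
case: pp' => [pp'|[D [cD D0 D1 Ds]]]; first by left;
  exact: (path_equiv_glue hp hq pp').
have I0 : 0 \in I01 by rewrite inE /= bound_itvE.
have I1 : 1 \in I01 by rewrite inE /= bound_itvE.
right; exists (glue_deformation D q (last_arrow p)); split.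
- have [_ l0 g0] := Ds 0 I0; exact: (glue_deformation_continuous g0 hq l0 cD).
- by rewrite stage_glue_deformation ?D0.
- by rewrite stage_glue_deformation ?D1 //; have [_ <- _] := Ds 1 I1;
  rewrite D1.
- move=> s sI; have [fs ls gs] := Ds s sI.
  rewrite stage_glue_deformation // !first_arrow_glue !last_arrow_glue ls;
    split.
  + by move: fs; rewrite -D0; case: (D) => [k|k H t D'] //= ->.
  + by case: q {hq}.
  + exact: (is_gpath_glue gs hq).
Qed.

Lemma homotopic_on_concat x y z p p' q q' :
  is_gpath 0 1 x y p -> is_gpath 0 1 y z q ->
  homotopic_on 0 1 x y p p' -> homotopic_on 0 1 y z q q' ->
  homotopic_on 0 1 x z (raw_concat p q) (raw_concat p' q').
Proof.
have h0 : (0 : R) < 2^-1 by rewrite invr_gt0.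
move=> hp hq pp qq.
have hp' := (homotopic_on_gpath pp).1 hp.
have := is_gpath_rescale 0 h0 hp'; have := is_gpath_rescale 2^-1 h0 hq.
have := homotopic_on_rescale 0 h0 pp; have := homotopic_on_rescale 2^-1 h0 qq.
rewrite !mulr0 !mulr1 !addr0 add0r (_ : 2^-1 + 2^-1 = 1); last first.
  by rewrite [RHS](splitr 1) mul1r.
move=> {}qq {}pp {}hq {}hp.
apply: (@homotopic_on_trans _ _ _ _ _ _ (raw_concat p' q)).
  exact: (homotopic_on_glue_l hq pp).
exact: (homotopic_on_glue_r hp qq).
Qed.

End Congruence.

(** * Images of homotopies under a morphism *)

Section Map.
Context {R : realType} (K G : lie_groupoid R) (f : morphism K G).

Lemma continuous_fob : continuous (fob f).
Proof. by have [? _ _ _ _ _] := morP f;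
  apply: (smooth_continuous (ob_manifold (lieP K))). Qed.

Lemma continuous_far : continuous (far f).
Proof. by have [_ ? _ _ _ _] := morP f;
  apply: (smooth_continuous (ar_manifold (lieP K))). Qed.

(** A morphism preserves products and units, and inverses are unique. *)
Lemma far_inv (g : Ar K) : far f (ginv g) = ginv (far f g).
Proof.
have [_ _ fs ft fu fm] := morP f; have LK := lieP K; have LG := lieP G.
have e : gmul (far f (ginv g)) (far f g) = gunit (src (far f g)).
  by rewrite -fm ?(src_inv LK) // (gmulVl LK) fu fs.
rewrite -[LHS](gmul1 LG) fs (src_inv LK) -ft -(gmulV LG) (gmulA LG).
- by rewrite e -{1}(tgt_inv LG (far f g)) (gmul1l LG).
- by rewrite fs (src_inv LK) ft.
- by rewrite (tgt_inv LG).
Qed.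

Lemma raw_map_map_first (k : Ar K -> Ar K) (k' : Ar G -> Ar G) p :
  far f (k (first_arrow p)) = k' (far f (first_arrow p)) ->
  raw_map f (map_first k p) = map_first k' (raw_map f p).
Proof. by rewrite /raw_map; case: p => [g|g a t p] /= ->. Qed.

Lemma path_equiv_map u v x y p q : is_gpath u v x y p -> path_equiv u p q ->
  path_equiv u (raw_map f p) (raw_map f q).
Proof.
have [_ _ fs ft fu fm] := morP f; have LK := lieP K; have LG := lieP G.
move=> + pq; elim: pq x => {u p q} /=.
- move=> u g a t p s us x _; rewrite /raw_map /= fu.
  exact: (@PathSubdivide _ _ u (far f g) (fob f \o a) t (raw_map f p)).
- move=> u g a t p h ch sh x [gx ga ut ca pp].
  have [pf _] := is_gpath_ends pp.
  have sht : src (h t) = a t by rewrite sh // bound_itvE.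
  change (path_equiv u (Step (far f g) (fob f \o a) t (raw_map f p))
    (Step (far f (gmul (h u) g)) (fob f \o (@tgt R K \o h)) t
      (raw_map f (map_first (fun g' => gmul g' (ginv (h t))) p)))).
  rewrite (raw_map_map_first (k' := fun g' => gmul g' (ginv (far f (h t)))));
    last first.
    by rewrite fm ?far_inv // (tgt_inv LK) pf sht.
  rewrite fm; last by rewrite sh // bound_itvE.
  rewrite (_ : fob f \o (@tgt R K \o h) = @tgt R G \o (far f \o h)); last first.
    by apply/funext => r /=; rewrite ft.
  apply: (@PathTranslate R G u (far f g) (fob f \o a) t (raw_map f p)
    (far f \o h)).
    exact: (within_continuous_postcomp ch continuous_far).
  by move=> s sI /=; rewrite fs sh.
- move=> u g a t p q _ IH x [gx ga ut ca pp]; apply: PathLater; apply: IH pp.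
Qed.

Definition map_deformation (D : gseq R (R -> Ar K) (R * R -> Ob K)) :=
  gseq_map (fun g => far f \o g) (fun H => fob f \o H) D.

Lemma stage_map_deformation D s :
  stage (map_deformation D) s = raw_map f (stage D s).
Proof. by rewrite /stage /raw_map !gseq_map_comp. Qed.

Lemma map_deformation_continuous u D : deformation_continuous u D ->
  deformation_continuous u (map_deformation D).
Proof.
elim: D u => [g|g H t D IH] u /=.
  by move=> cg; exact: within_continuous_postcomp continuous_far.
move=> [cg cH /IH cD]; split=> //.
  exact: within_continuous_postcomp continuous_far.
exact: within_continuous_postcomp continuous_fob.
Qed.

Lemma homotopic_on_map u v x y p q : homotopic_on u v x y p q ->
  homotopic_on u v (fob f x) (fob f y) (raw_map f p) (raw_map f q).
Proof.
elim=> {p q} [p q|p|p q _ IH|p q r _ IH1 _ IH2].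
- move=> [hp hq pq]; apply: rst_step; split;
  [exact: is_gpath_map|exact: is_gpath_map|].
  case: pq => [pq|[D [cD D0 D1 Ds]]]; first by left;
    exact: (path_equiv_map hp pq).
  right; exists (map_deformation D); split.
  + exact: map_deformation_continuous.
  + by rewrite stage_map_deformation D0.
  + by rewrite stage_map_deformation D1.
  + move=> s sI; have [fs ls gs] := Ds s sI; rewrite stage_map_deformation.
    rewrite /raw_map !(first_arrow_map (far f)) !(last_arrow_map (far f)) fs ls;
      split=> //.
    exact: is_gpath_map.
- exact: homotopic_on_refl.
- exact: homotopic_on_sym.
- exact: (homotopic_on_trans IH1 IH2).
Qed.

End Map.

(** * Homotopy classes *)

Section Classes.
Context {R : realType} (G : lie_groupoid R).
Let LG := lieP G.

Notation I01 := (`[0, 1]%classic : set R).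
Notation raw_path := (gseq R (Ar G) (R -> Ob G)).
Implicit Types (u v t : R) (x y z : Ob G) (p q w : raw_path) (g : Ar G)
  (r s : path_class G).

Lemma gval_inj (p q : gpath G) : gval p = gval q -> p = q.
Proof.
case: p q => [p hp] [q hq] /= E; move: hp hq; rewrite E => hp hq.
by congr GPath; exact: Prop_irrelevance.
Qed.

Lemma pi_homotopic (p q : gpath G) :
  \pi_(path_class G) p = \pi_(path_class G) q <-> homotopic p q.
Proof. by split=> [/eqmodP/asboolP|pq]; last exact/eqmodP/asboolP. Qed.

Lemma homotopic_on_homotopic x y p q (hp : is_gpath 0 1 x y p)
    (hq : is_gpath 0 1 x y q) :
  homotopic_on 0 1 x y p q -> homotopic (mk_gpath hp) (mk_gpath hq).
Proof.
move=> pq; elim: pq hp hq =>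
  {p q} [p q [gp gq pq]|p|p q _ IH|p q r pq IH1 _ IH2] hp hq.
- apply: rst_step => /=; case: pq => [?|[D [cD D0 D1 Ds]]]; [by left|right].
  exists D; split=> // s /Ds[fs ls gs]; split=> //.
  by have [-> ->] := is_gpath_ends hp.
- rewrite (gval_inj (p := mk_gpath hp) (q := mk_gpath hq)) //; exact: rst_refl.
- exact/rst_sym/IH.
(* The intermediate raw sequence is a path too, so it can be promoted to a [gpath]. *)
- have hr := (homotopic_on_gpath pq).1 hp.
  exact: rst_trans (IH1 hp hr) (IH2 hr hq).
Qed.

Lemma path_equiv_ends u v v' x x' y y' p q : path_equiv u p q ->
  is_gpath u v x y p -> is_gpath u v' x' y' q -> x = x' /\ y = y'.
Proof.
move=> pq hp hq; have := path_equiv_gpath pq hp.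
by move=> /is_gpath_ends[<- <-]; have [<- <-] := is_gpath_ends hq.
Qed.

(** The type [gpath] does not record the ends, so their invariance is proved along the chain,
    together with the passage to [homotopic_on]. *)
Lemma homotopic_homotopic_on (p q : gpath G) : homotopic p q ->
  [/\ gpath_src p = gpath_src q, gpath_tgt p = gpath_tgt q &
    homotopic_on 0 1 (gpath_src p) (gpath_tgt p) p q].
Proof.
elim=> {p q} [p q pq|p|p q _ [-> -> IH]|p q r _ [e1 e2 IH1] _ [e3 e4 IH2]].
- have [ps pt] : gpath_src p = gpath_src q /\ gpath_tgt p = gpath_tgt q.
    case: pq => [pq|[D [_ _ D1 Ds]]].
      exact: (path_equiv_ends pq (gpathP p) (gpathP q)).
    have [|fs ls _] := Ds 1; first by rewrite inE /= bound_itvE.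
    by rewrite /gpath_src /gpath_tgt -D1 fs ls.
  split=> //; apply: rst_step; split; first exact: gpathP.
    by rewrite ps pt; exact: gpathP.
  by case: pq => [?|?]; [left|right].
- by split=> //; exact: homotopic_on_refl.
- by split=> //; exact: homotopic_on_sym.
- rewrite e1 e2 in IH1 *; split=> //; exact: (homotopic_on_trans IH1 IH2).
Qed.

Definition hclass x y p (hp : is_gpath 0 1 x y p) : path_class G :=
  \pi_(path_class G) (mk_gpath hp).

Lemma hclass_eq x y p q (hp : is_gpath 0 1 x y p) (hq : is_gpath 0 1 x y q) :
  homotopic_on 0 1 x y p q -> hclass hp = hclass hq.
Proof. by move=> pq; apply/pi_homotopic/homotopic_on_homotopic. Qed.

(** Allows the ends in the type of the validity proof to be changed along equalities; the class
    depends on the raw path alone. *)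
Lemma hclass_irr x y x' y' p p' (hp : is_gpath 0 1 x y p)
  (hp' : is_gpath 0 1 x' y' p') : p = p' -> hclass hp = hclass hp'.
Proof.
by move=> pp'; rewrite /hclass; congr (\pi_(path_class G) _); exact: gval_inj.
Qed.

Lemma hclass_ex s x y : class_src s = x -> class_tgt s = y ->
  exists p (hp : is_gpath 0 1 x y p), s = hclass hp.
Proof.
move=> <- <-.
exists (repr s), (gpathP (repr s)); rewrite -[LHS]reprK /hclass.
by congr (\pi_(path_class G) _); exact: gval_inj.
Qed.

Lemma hclass_repr x y p (hp : is_gpath 0 1 x y p) :
  homotopic_on 0 1 x y (repr (hclass hp)) p.
Proof.
have /pi_homotopic/homotopic_homotopic_on : repr (hclass hp)
  = mk_gpath hp %[mod path_class G].
  by rewrite reprK.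
by rewrite /gpath_src /gpath_tgt /=; have [-> ->] := is_gpath_ends hp; case=> ->
  ->.
Qed.

Lemma class_src_hclass x y p (hp : is_gpath 0 1 x y p) : class_src (hclass hp)
    = x.
Proof.
have /homotopic_on_gpath[_ /(_ hp)/is_gpath_ends[]] := hclass_repr hp.
by [].
Qed.

Lemma class_tgt_hclass x y p (hp : is_gpath 0 1 x y p) : class_tgt (hclass hp)
    = y.
Proof.
have /homotopic_on_gpath[_ /(_ hp)/is_gpath_ends[]] := hclass_repr hp.
by [].
Qed.

(** [class_mul] concatenates chosen representatives; these are homotopic to [p] and [q], and
    concatenation respects homotopy. *)
Lemma class_mul_hclass x y z p q (hp : is_gpath 0 1 x y p)
    (hq : is_gpath 0 1 y z q) (hpq : is_gpath 0 1 x z (raw_concat p q)) :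
  class_mul (hclass hq) (hclass hp) = hclass hpq.
Proof.
rewrite /class_mul; case: pselect => [e|]; last first.
  by rewrite class_src_hclass class_tgt_hclass.
apply/pi_homotopic.
have hp' := (homotopic_on_gpath (hclass_repr hp)).2 hp.
have hq' := (homotopic_on_gpath (hclass_repr hq)).2 hq.
have hpq' := is_gpath_concat hp' hq'.
rewrite (_ : gpath_concat e = mk_gpath hpq'); last exact: gval_inj.
apply: homotopic_on_homotopic.
exact: (homotopic_on_concat hp' hq' (hclass_repr hp) (hclass_repr hq)).
Qed.

Lemma class_mul_eq x y z p q (r : raw_path) (hp : is_gpath 0 1 x y p)
    (hq : is_gpath 0 1 y z q) (hr : is_gpath 0 1 x z r) :
  homotopic_on 0 1 x z (raw_concat p q) r ->
  class_mul (hclass hq) (hclass hp) = hclass hr.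
Proof.
move=> pqr; rewrite (class_mul_hclass _ _ (is_gpath_concat hp hq)).
exact: hclass_eq.
Qed.

Lemma class_src_mul s r : class_src s = class_tgt r ->
  class_src (class_mul s r) = class_src r.
Proof.
move Ey: (class_tgt r) => y /hclass_ex/(_ erefl)[q [hq ->]].
have [p [hp ->]] := hclass_ex erefl Ey.
rewrite class_src_hclass (class_mul_hclass _ _ (is_gpath_concat hp hq)).
by rewrite class_src_hclass.
Qed.

Lemma class_tgt_mul s r : class_src s = class_tgt r ->
  class_tgt (class_mul s r) = class_tgt s.
Proof.
move Ez: (class_tgt s) => z.
move Ey: (class_tgt r) => y /hclass_ex/(_ Ez)[q [hq ->]].
have [p [hp ->]] := hclass_ex erefl Ey.
rewrite (class_mul_hclass _ _ (is_gpath_concat hp hq)).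
by rewrite class_tgt_hclass.
Qed.

Lemma glueA p q (r : raw_path) : tgt (last_arrow p) = src (first_arrow q) ->
  tgt (last_arrow q) = src (first_arrow r) ->
  Defs.glue (Defs.glue p q) r = Defs.glue p (Defs.glue q r).
Proof.
elim: p => [g|g a t p IH] /= gq qr; last by rewrite IH.
case: q gq qr => [k|k a t q] //= gk kr.
by rewrite (map_first_comp (h := fun g' => gmul g' (gmul k g))) // (gmulA LG).
Qed.

Lemma realizes_concat x y w w' p q : is_gpath 0 1 x y p ->
  realizes 0 w p -> realizes 0 w' q ->
  realizes 0 (Defs.glue w w') (raw_concat p q).
Proof.
have h0 : (0 : R) < 2^-1 by rewrite invr_gt0.
move=> /(is_gpath_rescale 0 h0) + /(realizes_rescale 0 h0) +
  /(realizes_rescale 2^-1 h0).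
by rewrite !mulr0 !mulr1 !addr0 add0r; exact: realizes_glue.
Qed.

(** Both bracketings realize the same word, since gluing is associative by [glueA]; they differ only
    in their times. *)
Lemma class_mulA r s k : class_src r = class_tgt s ->
    class_src s = class_tgt k ->
  class_mul r (class_mul s k) = class_mul (class_mul r s) k.
Proof.
move Ez: (class_tgt s) => z; move Ey: (class_tgt k) => y.
move=> /hclass_ex/(_ erefl)[p3 [h3 ->]] /hclass_ex/(_ Ez)[p2 [h2 ->]].
have [p1 [h1 ->]] := hclass_ex erefl Ey.
have h12 := is_gpath_concat h1 h2; have h23 := is_gpath_concat h2 h3.
rewrite (class_mul_hclass _ _ h12) (class_mul_hclass _ _ h23).
rewrite (class_mul_hclass _ _ (is_gpath_concat h12 h3)).
rewrite (class_mul_hclass _ _ (is_gpath_concat h1 h23)).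
apply: hclass_eq.
have r1 := word_of_realizes h1; have r2 := word_of_realizes h2.
have r3 := word_of_realizes h3.
apply: (@realizes_homotopic _ _
  (Defs.glue (Defs.glue (word_of 0 p1) (word_of 0 p2)) (word_of 0 p3))).
- exact: is_gpath_concat h12 h3.
- exact: is_gpath_concat h1 h23.
- by apply: (realizes_concat h12) => //; exact: (realizes_concat h1 r1 r2).
- rewrite glueA.
  + by apply: (realizes_concat h1) => //; exact: (realizes_concat h2 r2 r3).
  + rewrite (last_arrow_realizes r1) (first_arrow_realizes r2).
    by have [_ ->] := is_gpath_ends h1; have [-> _] := is_gpath_ends h2.
  + rewrite (last_arrow_realizes r2) (first_arrow_realizes r3).
    by have [_ ->] := is_gpath_ends h2; have [-> _] := is_gpath_ends h3.
Qed.

End Classes.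

(** * Generators of the fundamental groupoid *)

Section Generators.
Context {R : realType} (G : lie_groupoid R).
Let LG := lieP G.

Notation I01 := (`[0, 1]%classic : set R).
Notation raw_path := (gseq R (Ar G) (R -> Ob G)).
Implicit Types (u v t : R) (x y z : Ob G) (p q w : raw_path) (g k : Ar G)
  (A : R -> Ob G).

(** A wait at the target of [g], followed by an identity jump, is a delayed start of [A]. *)
Lemma realizes_merge_first u v x y g A t1 t2 t3 w q : is_gpath u v x y q ->
  realizes u (Step g (fun=> tgt g) t1 (Step (gunit (tgt g)) A t2 w)) q ->
  exists q', homotopic_on u v x y q q' /\ realizes u (Step g A t3 w) q'.
Proof.
case: q => [? _ []|g' a t q]; case: q =>
  [? _ [_ _ []]|k b t' q] hq [ge [_ [l [cl la lends]]] [ke Ab wq]].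
subst g' k; have [gx ga ut ca [_ + tt' cb hq']] := hq.
have atg s : s \in `[u, t] -> a s = tgt g by move=> sI; have [] := la s sI.
have att : a t = tgt g by rewrite atg // bound_itvE.
rewrite (tgt_unit LG) => bt.
exists (Step g (fun s => b (Num.max s t)) t' q); split.
  rewrite -att; apply: homotopic_on_merge; first by rewrite att.
    move=> s sI; rewrite max_r ?atg ?bt //.
    by move: sI; rewrite in_itv /= => /andP[].
  by move=> s; rewrite in_itv /= => /andP[ts _]; rewrite max_l.
by split => //; apply: runs_through_maxl => //; apply/andP.
Qed.

(** Translating the initial wait by [g] itself turns it into a wait after [g], which reduces to
    [realizes_merge_first]. *)
Lemma realizes_merge_unit u v x y g A t1 t2 t3 w q : is_gpath u v x y q ->
  realizes u (Step (gunit (src g)) (fun=> src g) t1 (Step g A t2 w)) q ->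
  exists q', homotopic_on u v x y q q' /\ realizes u (Step g A t3 w) q'.
Proof.
case: q => [? _ []|g' a t q]; case: q =>
  [? _ [_ _ []]|k b t' q] hq [ge [_ [l [cl la lends]]] [ke Ab wq]].
subst g' k.
have asg s : s \in `[u, t] -> a s = src g by move=> sI; have [] := la s sI.
have e1 := homotopic_on_translate hq asg.
have hq1 := (homotopic_on_gpath e1).1 hq.
have [|q' [e2 wq']] := @realizes_merge_first u v x y g A t1 t2 t3 w _ hq1.
  rewrite (gmul1 LG) /= (gmulV LG); split=> //; split; first by move=> s;
    exact: cvg_cst.
  by exists l; split=> // [s sI|]; [split=> //; have [] := la s sI | right].
by exists q'; split=> //; exact: (homotopic_on_trans e1 e2).
Qed.

(** Translating the final wait by the inverse of [k] moves the jump [k] to the final time and leaves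
    a wait at the end of [A]. *)
Lemma realizes_merge_last u v x y g A k t1 t2 t3 q : is_gpath u v x y q ->
  realizes u (Step g A t1 (Step k (fun=> tgt k) t2 (End _ _ (gunit (tgt k))))) q
    ->
  exists q', homotopic_on u v x y q q' /\ realizes u (Step g A t3 (End _ _ k))
    q'.
Proof.
case: q => [? _ []|g' a t q]; case: q => [? _ [_ _ []]|k' b t' q];
  case: q => [k''|? ? ? ? _ [_ _ [_ _ []]]] hq
    [ge Aa [ke [_ [l [cl lb lends]]] /= k2]].
subst g' k' k''; have [gx ga ut ca _] := hq.
have hq1 : is_gpath t v (a t) y (Step k b t' (End _ _ (gunit (tgt k)))).
  by case: hq.
have [ka _ tt' _ [_ ky t'v]] := hq1.
have bk s : s \in `[t, t'] -> b s = src (ginv k).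
  by move=> sI; have [_ ->] := lb s sI; rewrite (src_inv LG).
have e1 := homotopic_on_translate hq1 bk.
move: e1; rewrite (gmulVl LG) (tgt_inv LG) ka /= ginvK (gmul1l LG) => e1.
have e2 : homotopic_on u v x y
  (Step g a t (Step k b t' (End _ _ (gunit (tgt k)))))
    (Step g a t (Step (gunit (a t)) (fun=> a t) t' (End _ _ k))).
  exact: homotopic_on_Step.
have hq2 := (homotopic_on_gpath e2).1 hq.
exists (Step g (fun s => a (Num.min s t)) t' (End _ _ k)); split.
  apply: (homotopic_on_trans e2); apply: homotopic_on_merge => // s;
    rewrite in_itv /= => /andP[s1 s2]; by [rewrite min_l | rewrite min_r].
by split=> //; apply: runs_through_minl => //; apply/andP.
Qed.

(** The last path of [w] absorbs the wait. A lone arrow is excluded, because it is a path only on an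
    interval of length zero. *)
Lemma realizes_merge_end u v x y w t q : is_gpath u v x y q ->
  (forall k, w <> End _ _ k) -> tgt (last_arrow w) = y ->
  realizes u (Defs.glue w (Step (gunit y) (fun=> y) t (End _ _ (gunit y)))) q ->
  exists q', homotopic_on u v x y q q' /\ realizes u w q'.
Proof.
elim: w u x q => [k|g A t0 w IH] u x q hq.
  by move=> /(_ k).
move=> _ wy.
case: w IH wy => [k _ /= ky|g1 A1 t1 w IH wy].
  by subst y; rewrite (gmul1l LG); exact: realizes_merge_last.
case: q hq => [? _ []|g' a t' q hq [ge Aa wq]]; subst g'.
have [gx ga ut ca hq1] := hq.
have [//|//|//|q' [e wq']] := IH t' (a t') q hq1.
by exists (Step g a t' q'); split => //; exact: homotopic_on_Step.
Qed.

Lemma realizes_simple g A t k : {within I01, continuous A} ->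
  realizes 0 (Step g A t (End _ _ k)) (Step g A 1 (End _ _ k)).
Proof.
move=> cA; split=> //; split=> //; exists id; split=> //; last by left.
by move=> r; exact: cvg_id.
Qed.

Lemma translate_simple x y g (h : R -> Ar G) k :
  is_gpath 0 1 x y (Step g (@src R G \o h) 1 (End _ _ k)) ->
  {within I01, continuous h} ->
  homotopic_on 0 1 x y (Step g (@src R G \o h) 1 (End _ _ k))
    (Step (gmul (h 0) g) (@tgt R G \o h) 1 (End _ _ (gmul k (ginv (h 1))))).
Proof.
move=> hp ch; apply: path_equiv_homotopic_on => //.
exact: (@PathTranslate R G 0 g (@src R G \o h) 1 (End _ _ k) h).
Qed.

(** An arrow by itself takes no time, so a constant path at its target fills [0, 1]. *)
Lemma is_gpath_arrow g : is_gpath 0 1 (src g) (tgt g)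
  (Step g (fun=> tgt g) 1 (End _ _ (gunit (tgt g)))).
Proof.
split=> //=; first by move=> s; exact: cvg_cst.
by rewrite (src_unit LG) (tgt_unit LG).
Qed.

Definition arrow_class g : path_class G := hclass (is_gpath_arrow g).

Lemma class_src_arrow g : class_src (arrow_class g) = src g.
Proof. exact: class_src_hclass. Qed.

Lemma class_tgt_arrow g : class_tgt (arrow_class g) = tgt g.
Proof. exact: class_tgt_hclass. Qed.

Lemma class_mul_arrow_r y g A k
    (hq : is_gpath 0 1 (tgt g) y (Step (gunit (tgt g)) A 1 (End _ _ k)))
    (hr : is_gpath 0 1 (src g) y (Step g A 1 (End _ _ k))) :
  class_mul (hclass hq) (arrow_class g) = hclass hr.
Proof.
have hp := is_gpath_arrow g; have hpq := is_gpath_concat hp hq.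
apply: class_mul_eq; have [_ _ _ cA _] := hq; have [_ _ _ cc _] := hp.
have := realizes_concat hp (realizes_simple g 0 (gunit (tgt g)) cc)
  (realizes_simple (gunit (tgt g)) 0 k cA).
rewrite [Defs.glue _ _]/= (_ : gmul _ _ = gunit (tgt g)); last first.
  by have := gmul1l LG (gunit (tgt g)); rewrite (tgt_unit LG).
move=> /(realizes_merge_first 0 hpq)[q' [e wq']].
apply: (homotopic_on_trans e);
  apply: realizes_homotopic wq' (realizes_simple _ _ _ cA).
  exact: (homotopic_on_gpath e).1 hpq.
exact: hr.
Qed.

Lemma class_mul_arrow_l x g A k
    (hp : is_gpath 0 1 x (src k) (Step g A 1 (End _ _ (gunit (src k)))))
    (hr : is_gpath 0 1 x (tgt k) (Step g A 1 (End _ _ k))) :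
  class_mul (arrow_class k) (hclass hp) = hclass hr.
Proof.
have hq := is_gpath_arrow k; have hpq := is_gpath_concat hp hq.
apply: class_mul_eq; have [_ _ _ cA _] := hp; have [_ _ _ cc _] := hq.
have := realizes_concat hp (realizes_simple g 0 (gunit (src k)) cA)
  (realizes_simple k 0 (gunit (tgt k)) cc).
rewrite [Defs.glue _ _]/= (gmul1 LG).
move=> /(realizes_merge_last 0 hpq)[q' [e wq']].
apply: (homotopic_on_trans e);
  apply: realizes_homotopic wq' (realizes_simple _ _ _ cA).
  exact: (homotopic_on_gpath e).1 hpq.
exact: hr.
Qed.

Lemma class_of_pathE (a : R -> Ob G) (ca : {within I01, continuous a}) :
  class_of_path ca = hclass (is_gpath_path ca).
Proof. by []. Qed.

Lemma arrow_class_mul g k : src k = tgt g ->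
  class_mul (arrow_class k) (arrow_class g) = arrow_class (gmul k g).
Proof.
move=> kg; have [_ _ _ cc _] := is_gpath_arrow g.
have hp : is_gpath 0 1 (src g) (src k)
  (Step g (fun=> tgt g) 1 (End _ _ (gunit (src k)))).
  by split=> //=; rewrite (src_unit LG) (tgt_unit LG).
have hr : is_gpath 0 1 (src g) (tgt k) (Step g (fun=> tgt g) 1 (End _ _ k)).
  by split.
rewrite (_ : arrow_class g = hclass hp); last by apply: hclass_irr; rewrite kg.
rewrite (class_mul_arrow_l _ hr).
have hm : is_gpath 0 1 (src g) (tgt k)
    (Step (gmul k g) (fun=> tgt k) 1 (End _ _ (gunit (tgt k)))).
  by have := is_gpath_arrow (gmul k g); rewrite (src_mul LG) // (tgt_mul LG).
rewrite (_ : arrow_class _ = hclass hm); last first.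
  by apply: hclass_irr; rewrite (tgt_mul LG).
(* Translation of the wait between [g] and [k] by [k] itself gathers both jumps at time 0. *)
apply: hclass_eq; have := @translate_simple (src g) (tgt k) g (fun=> k) k.
rewrite (gmulV LG) /comp kg; apply; first exact: hr.
by move=> s; exact: cvg_cst.
Qed.

(** Both sides are classes of paths with a single step, (h(0), t h, 1) and (1, s h, h(1)), and one
    translation along [h] carries the second to the first. *)
Lemma class_mul_path_arrow (h : R -> Ar G)
    (cs : {within I01, continuous (@src R G \o h)})
    (ct : {within I01, continuous (@tgt R G \o h)}) : {within I01, continuous h}
        ->
  class_mul (class_of_path ct) (arrow_class (h 0)) =
  class_mul (arrow_class (h 1)) (class_of_path cs).
Proof.
move=> ch; have hl : is_gpath 0 1 (src (h 0)) (tgt (h 1))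
    (Step (h 0) (@tgt R G \o h) 1 (End _ _ (gunit (tgt (h 1))))).
  by split=> //=; rewrite (src_unit LG) (tgt_unit LG).
have hr : is_gpath 0 1 (src (h 0)) (tgt (h 1))
    (Step (gunit (src (h 0))) (@src R G \o h) 1 (End _ _ (h 1))).
  by split=> //=; rewrite ?(src_unit LG) ?(tgt_unit LG).
rewrite !class_of_pathE.
have -> := @class_mul_arrow_r _ _ _ _ (is_gpath_path ct) hl.
have -> := @class_mul_arrow_l _ _ _ _ (is_gpath_path cs) hr.
apply/esym/hclass_eq; have := translate_simple hr ch.
by rewrite (gmul1 LG) (gmulV LG).
Qed.

Lemma class_mul1 (s : path_class G) : class_mul s (class_unit (class_src s))
    = s.
Proof.
have [p [hp se]] := hclass_ex (erefl (class_src s)) (erefl (class_tgt s)).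
rewrite [X in class_mul X]se [RHS]se {se}.
move: (class_src s) (class_tgt s) hp => x y hp; apply: class_mul_eq.
have hu := is_gpath_path (@constant_path_continuous _ G x).
have hpq := is_gpath_concat hu hp.
have wp := word_of_realizes hp; have [_ _ _ cc _] := hu.
have := realizes_concat hu (realizes_simple (gunit x) 0 (gunit x) cc) wp.
case: p hp hpq wp => [g [_ _ /eqP]|g a t p hp hpq wp].
  by rewrite eq_sym oner_eq0.
have [gx _ _ _ _] := hp; subst x; rewrite [Defs.glue _ _]/= (gmul1 LG).
move=> /(realizes_merge_unit t hpq)[q' [e wq']].
apply: (homotopic_on_trans e); apply: realizes_homotopic wq' wp => //.
exact: (homotopic_on_gpath e).1 hpq.
Qed.

Lemma class_mul1l (s : path_class G) : class_mul (class_unit (class_tgt s)) s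
    = s.
Proof.
have [p [hp se]] := hclass_ex (erefl (class_src s)) (erefl (class_tgt s)).
rewrite [in X in class_mul _ X]se [RHS]se {se}.
move: (class_src s) (class_tgt s) hp => x y hp; apply: class_mul_eq.
have hu := is_gpath_path (@constant_path_continuous _ G y).
have hpq := is_gpath_concat hp hu.
have wp := word_of_realizes hp; have [_ _ _ cc _] := hu.
have := realizes_concat hp wp (realizes_simple (gunit y) 0 (gunit y) cc).
have lp : tgt (last_arrow (word_of 0 p)) = y.
  by rewrite (last_arrow_realizes wp); have [] := is_gpath_ends hp.
have np k : word_of 0 p <> End _ _ k.
  by case: (p) hp => [g [_ _ /eqP]|//]; rewrite eq_sym oner_eq0.
move=> /(realizes_merge_end hpq np lp)[q' [e wq']].
apply: (homotopic_on_trans e); apply: realizes_homotopic wq' wp => //.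
exact: (homotopic_on_gpath e).1 hpq.
Qed.

(** A product of generators is built along a representative so as to realize its word, and is then
    identified with the given class by [realizes_homotopic]. *)
Lemma class_ind (P : path_class G -> Prop) :
  (forall g, P (arrow_class g)) ->
  (forall a (ca : {within I01, continuous a}), P (class_of_path ca)) ->
  (forall r s, class_src r = class_tgt s -> P r -> P s -> P (class_mul r s)) ->
  forall s, P s.
Proof.
move=> Parr Ppath Pmul s.
(* The final wait comes from the class of the last arrow, which is completed by a constant path. *)
pose c y : raw_path := Step (gunit y) (fun=> y) 0 (End _ _ (gunit y)).
(* Tails live on [u, v] but classes on [0, 1]; the word, being free of times, links the two. *)
have key p : forall u v x y, is_gpath u v x y p ->
  exists q (hq : is_gpath 0 1 x y q),
    realizes 0 (Defs.glue (word_of u p) (c y)) q /\ P (hclass hq).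
  elim: p => [g|g a t p IH] u v x y.
    case=> gx gy _; subst x y.
    exists _, (is_gpath_arrow g); split; last exact: Parr.
    rewrite /= (gmul1l LG); have [_ _ _ cc _] := is_gpath_arrow g.
    exact: realizes_simple.
  move=> hp; pose A s := a (u + s * (t - u)).
  have [_ Aa _] : realizes u (Step g A t (word_of t p)) (Step g a t p).
    exact: word_of_realizes hp.
  have [gx ga ut ca hp1] := hp; have [A0 A1] := runs_through_ends ut Aa.
  have [cA _] := Aa; have [q [hq [wq Pq]]] := IH _ _ _ _ hp1.
  pose gA : raw_path := Step g A 1 (End _ _ (gunit (a t))).
  have hgA : is_gpath 0 1 x (a t) gA.
    by split=> //; rewrite ?ga ?A0 //= (src_unit LG) (tgt_unit LG) A1.
  exists (raw_concat gA q), (is_gpath_concat hgA hq); split; last first.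
    rewrite -(class_mul_hclass hgA hq); apply: (Pmul) => //.
      by rewrite class_src_hclass class_tgt_hclass.
    have cA' : is_gpath 0 1 (tgt g) (a t)
      (Step (gunit (tgt g)) A 1 (End _ _ (gunit (a t)))).
      by split=> //=; rewrite ?(src_unit LG) ?(tgt_unit LG) -?A1 // ga A0.
    have hgA2 : is_gpath 0 1 (src g) (a t) gA by rewrite gx.
    rewrite (_ : hclass hgA = hclass hgA2); last exact: hclass_irr.
    rewrite -(class_mul_arrow_r cA'); apply: (Pmul).
    - by rewrite class_src_hclass class_tgt_hclass.
    - rewrite (_ : hclass cA' = class_of_path cA) //.
      by apply: hclass_irr; rewrite /raw_of_path -A0 -A1 -ga.
    - exact: Parr.
  have := realizes_concat hgA (realizes_simple g t (gunit (a t)) cA) wq.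
  rewrite [X in realizes _ X](_ : _
    = Step g A t (Defs.glue (word_of t p) (c y))) //.
  congr Step; apply: map_first_id.
  have [qx _] := is_gpath_ends hq.
  by rewrite (first_arrow_realizes wq) -qx (gmul1 LG).
have [p [hp se]] := hclass_ex (erefl (class_src s)) (erefl (class_tgt s)).
have [q [hq [wq Pq]]] := key p 0 1 _ _ hp.
have hu := is_gpath_path (@constant_path_continuous _ G (class_tgt s)).
have -> : s = hclass hq; last exact: Pq.
(* Multiplication by the unit appends to [s] the same final wait as in the word of [q]. *)
rewrite -[LHS]class_mul1l [X in class_mul _ X = _]se; apply: class_mul_eq.
have [_ _ _ cc _] := hu.
apply: realizes_homotopic wq; [exact: is_gpath_concat hp hu|exact: hq|].
apply: (realizes_concat hp (word_of_realizes hp)).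
exact: (realizes_simple (gunit (class_tgt s)) 0 (gunit (class_tgt s)) cc).
Qed.

End Generators.

(** * Induced morphisms and squares *)

Section InducedFunctor.
Context {R : realType} (K G : lie_groupoid R) (f : morphism K G).

Notation I01 := (`[0, 1]%classic : set R).

Lemma far_induced_hclass x y p (hp : @is_gpath R K 0 1 x y p) :
  far (Defs.induced f) (hclass hp) = hclass (is_gpath_map f hp).
Proof.
rewrite /=; set h := repr _.
have hh : is_gpath 0 1 x y h := (homotopic_on_gpath (hclass_repr hp)).2 hp.
rewrite (_ : gpath_map f h = mk_gpath (is_gpath_map f hh));
  last exact: gval_inj.
by apply: hclass_eq; apply: homotopic_on_map; exact: hclass_repr.
Qed.

Lemma raw_map_rescale (c d : R) p :
  raw_map f (rescale c d p) = rescale c d (raw_map f p).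
Proof. by rewrite /raw_map; elim: p => //= g a t p ->. Qed.

Lemma raw_map_glue p q : tgt (last_arrow p) = src (first_arrow q) ->
  raw_map f (Defs.glue p q) = Defs.glue (raw_map f p) (raw_map f q).
Proof.
have [_ _ _ _ _ fm] := morP f; rewrite /raw_map.
elim: p => [g|g a t p IH] /= pq; last by rewrite IH.
by case: q pq => [k|k a t q] /= e; rewrite fm.
Qed.

Lemma far_induced_mul r s : class_src r = class_tgt s ->
  far (Defs.induced f) (class_mul r s) =
  class_mul (far (Defs.induced f) r) (far (Defs.induced f) s).
Proof.
move Ey: (class_tgt s) => y /hclass_ex/(_ erefl)[q [hq ->]].
have [p [hp ->]] := hclass_ex erefl Ey.
have hpq := is_gpath_concat hp hq.
rewrite (class_mul_hclass _ _ hpq) !far_induced_hclass.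
rewrite (class_mul_hclass _ _
  (is_gpath_concat (is_gpath_map f hp) (is_gpath_map f hq))).
apply: hclass_irr; rewrite /raw_concat raw_map_glue ?raw_map_rescale //.
rewrite first_arrow_rescale last_arrow_rescale.
by have [_ ->] := is_gpath_ends hp; have [-> _] := is_gpath_ends hq.
Qed.

Lemma far_induced_arrow g :
  far (Defs.induced f) (arrow_class g) = arrow_class (far f g).
Proof.
have [_ _ fs ft fu _] := morP f.
rewrite far_induced_hclass; apply: hclass_irr.
by rewrite /raw_map /= ft fu.
Qed.

Lemma far_induced_path (a : R -> Ob K) (ca : {within I01, continuous a})
    (cfa : {within I01, continuous (fob f \o a)}) :
  far (Defs.induced f) (class_of_path ca) = class_of_path cfa.
Proof.
have [_ _ fs ft fu _] := morP f.
rewrite class_of_pathE far_induced_hclass; apply: hclass_irr.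
by rewrite /raw_map /raw_of_path /= !fu.
Qed.

End InducedFunctor.

(** * Products of path classes and continuous squares *)

Section Squares.
Context {R : realType} (G : lie_groupoid R).
Let LG := lieP G.
Notation I01 := (`[0, 1]%classic : set R).
Notation raw_path := (gseq R (Ar G) (R -> Ob G)).

Lemma class_src_path (a : R -> Ob G) (ca : {within I01, continuous a}) :
  class_src (class_of_path ca) = a 0.
Proof. exact: class_src_hclass. Qed.

Lemma class_tgt_path (a : R -> Ob G) (ca : {within I01, continuous a}) :
  class_tgt (class_of_path ca) = a 1.
Proof. exact: class_tgt_hclass. Qed.

Lemma class_of_path_eq (a b : R -> Ob G) (ca : {within I01, continuous a})
    (cb : {within I01, continuous b}) : a = b ->
        class_of_path ca = class_of_path cb.
Proof. by move=> ab; apply: hclass_irr; rewrite ab. Qed.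

Lemma class_mul_path (a b c : R -> Ob G) (ca : {within I01, continuous a})
    (cb : {within I01, continuous b}) (cc : {within I01, continuous c}) :
  a 1 = b 0 ->
  (forall r, 0 <= r <= 2^-1 -> c r = a (r / 2^-1)) ->
  (forall r, 2^-1 <= r <= 1 -> c r = b ((r - 2^-1) / 2^-1)) ->
  class_mul (class_of_path cb) (class_of_path ca) = class_of_path cc.
Proof.
move=> ab cE1 cE2; have h0 : (0 : R) < 2^-1 by rewrite invr_gt0.
have h1 : (2^-1 : R) <= 1 by rewrite invf_le1 // ler1n.
have hh : 2^-1 + 2^-1 = 1 :> R by rewrite [RHS](splitr 1) mul1r.
have ha := is_gpath_path ca; have hb : is_gpath 0 1 (a 1) (b 1) (raw_of_path b).
  by rewrite ab; exact: is_gpath_path.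
have c0 : c 0 = a 0 by rewrite cE1 ?mul0r // lexx ltW.
have c1 : c 1 = b 1.
  by rewrite cE2 ?lexx ?h1 // -{1}hh addrK divff // gt_eqF.
have hc : is_gpath 0 1 (a 0) (b 1) (raw_of_path c).
  by rewrite -c0 -c1; exact: is_gpath_path.
rewrite (_ : class_of_path cb = hclass hb); last exact: hclass_irr.
rewrite (_ : class_of_path cc = hclass hc); last exact: hclass_irr.
apply: class_mul_eq; have := is_gpath_concat ha hb.
rewrite /raw_concat /raw_of_path /= !mulr1 addr0 hh -ab.
(* The two identity arrows at the junction multiply to one, as [homotopic_on_merge] expects. *)
rewrite (_ : gmul (gunit (a 1)) (gunit (a 1)) = gunit (a 1)); last first.
  by have := gmul1l LG (gunit (a 1)); rewrite (tgt_unit LG).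
rewrite c0 c1 (_ : (fun r => a ((r - 0) / 2^-1)) = (fun r => a (r / 2^-1)));
  last first.
  by apply/funext => r; rewrite subr0.
have e : a 1 = a (2^-1 / 2^-1) by rewrite divff // gt_eqF.
rewrite [gunit (a 1)](_ : _ = gunit (a (2^-1 / 2^-1))); last by rewrite -e.
rewrite !subr0 => hp; apply: homotopic_on_merge => [|r|r]; first exact: hp.
  by rewrite in_itv /= => rI; exact: cE1.
by rewrite in_itv /= => rI; exact: cE2.
Qed.

Lemma path_deform (a b : R -> Ob G) (ca : {within I01, continuous a})
    (cb : {within I01, continuous b}) (H : R * R -> Ob G) :
  {within I01 `*` I01, continuous H} ->
  (forall r, r \in `[0, 1] -> H (r, 0) = a r /\ H (r, 1) = b r) ->
  (forall s, s \in `[0, 1] -> H (0, s) = a 0 /\ H (1, s) = a 1) ->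
  class_of_path ca = class_of_path cb.
Proof.
move=> cH Hab Hends; have ha := is_gpath_path ca.
have [a0 a1] : a 0 = b 0 /\ a 1 = b 1.
  have i0 : (0:R) \in `[0, 1] by rewrite bound_itvE.
  have i1 : (1:R) \in `[0, 1] by rewrite bound_itvE.
  have [_ <-] := Hab 0 i0; have [_ <-] := Hab 1 i1.
  by have [-> ->] := Hends 1 i1.
have hb : is_gpath 0 1 (a 0) (a 1) (raw_of_path b).
  by rewrite a0 a1; exact: is_gpath_path.
rewrite (_ : class_of_path cb = hclass hb); last exact: hclass_irr.
apply: hclass_eq; rewrite /raw_of_path -a0 -a1.
exact: (homotopic_on_deform_step ha cH).
Qed.

(* Both composites around the square are paths along its boundary, which are
   deformed into each other by convexity of the square. *)
Lemma class_mul_square (S : R * R -> Ob G)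
    (cS : {within I01 `*` I01, continuous S})
    (c1 : {within I01, continuous (fun r => S (r, 0))})
    (c2 : {within I01, continuous (fun s => S (1, s))})
    (c3 : {within I01, continuous (fun s => S (0, s))})
    (c4 : {within I01, continuous (fun r => S (r, 1))}) :
  class_mul (class_of_path c2) (class_of_path c1) =
  class_mul (class_of_path c4) (class_of_path c3).
Proof.
(* On [0, 1], [dn] rises in the first half and stays at 1, while [up] stays at 0 and rises in the
   second half. Thus (dn, up) follows the bottom and the right side of the square, and (up, dn) the
   left side and the top. *)
pose up (r : R) := Num.max 0 (Num.min ((r - 2^-1) / 2^-1) 1).
pose dn (r : R) := Num.max 0 (Num.min (r / 2^-1) 1).
have h0 : (0 : R) < 2^-1 by rewrite invr_gt0.
have h1 : (2^-1 : R) <= 1 by rewrite invf_le1 // ler1n.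
have hh : 2^-1 + 2^-1 = 1 :> R by rewrite [RHS](splitr 1) mul1r.
have h2 : (2^-1 : R) / 2^-1 = 1 by rewrite divff // gt_eqF.
have cup : continuous up.
  move=> r; apply: (@continuous_comp _ _ _ (fun r : R => (r - 2^-1) / 2^-1)
    (fun r => Num.max 0 (Num.min r 1))); last exact: clamp_continuous.
  exact: affine_inv_continuous.
have cdn : continuous dn.
  move=> r; apply: (@continuous_comp _ _ _ (fun r : R => r / 2^-1)
    (fun r => Num.max 0 (Num.min r 1))); last exact: clamp_continuous.
  by apply: (@cvgM _ _ (nbhs r)); [exact: cvg_id | exact: cvg_cst].
have clampI (r : R) : Num.max 0 (Num.min r 1) \in `[0, 1].
  by rewrite in_itv /= le_max lexx /= ge_max ler01 ge_min lexx orbT.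
have up1 r : r <= 2^-1 -> up r = 0.
  move=> rh; rewrite /up; apply/max_idPl; rewrite ge_min.
  by rewrite pmulr_lle0 ?invr_gt0 // subr_le0 rh.
have dn1 r : 2^-1 <= r -> dn r = 1.
  move=> rh; rewrite /dn min_r ?max_r // ?ler01 //.
  by rewrite ler_pdivlMr // mul1r.
have up2 r : 2^-1 <= r <= 1 -> up r = (r - 2^-1) / 2^-1.
  move=> /andP[r1 r2]; rewrite /up min_l ?max_r //.
    by rewrite divr_ge0 ?subr_ge0 // ltW.
  by rewrite ler_pdivrMr // mul1r lerBlDr hh.
have dn2 r : 0 <= r <= 2^-1 -> dn r = r / 2^-1.
  move=> /andP[r1 r2]; rewrite /dn min_l ?max_r //.
    by rewrite divr_ge0 // ltW.
  by rewrite ler_pdivrMr // mul1r.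
have cSc (k l : R -> R) : continuous k -> continuous l ->
    (forall r, k r \in `[0, 1]) -> (forall r, l r \in `[0, 1]) ->
    {within I01, continuous (fun r => S (k r, l r))}.
  move=> ck cl kI lI.
  apply: (@within_continuous_comp_within _ _ _ _ (I01 `*` I01)
    (fun r => (k r, l r)) S) cS.
    apply: continuous_subspaceT => r.
    by apply: continuous_pair_at; [exact: ck | exact: cl].
  by move=> r _; split=> /=; [exact: kI | exact: lI].
have upI r : up r \in `[0, 1] by exact: clampI.
have dnI r : dn r \in `[0, 1] by exact: clampI.
rewrite (class_mul_path _ _ (cSc dn up cdn cup dnI upI)) //; last 2 first.
- by move=> r /= rI; rewrite dn2 // up1 //; case/andP: rI.
- by move=> r /= rI; rewrite up2 // dn1 //; case/andP: rI.
rewrite (class_mul_path _ _ (cSc up dn cup cdn upI dnI)) //; last 2 first.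
- by move=> r /= rI; rewrite dn2 // up1 //; case/andP: rI.
- by move=> r /= rI; rewrite up2 // dn1 //; case/andP: rI.
have up_1 : up 1 = 1 by rewrite up2 ?lexx ?h1 // -{1}hh addrK.
have dn_0 : dn 0 = 0 by rewrite dn2 ?lexx ?ltW // mul0r.
have up_0 : up 0 = 0 by rewrite up1 // ltW.
have dn_1 : dn 1 = 1 by rewrite dn1.
pose H := S \o (fun z : R * R => ((1 - z.2) * dn z.1 + z.2 * up z.1,
                                  (1 - z.2) * up z.1 + z.2 * dn z.1)).
apply: (@path_deform _ _ _ _ H).
- apply: (within_continuous_comp_within _ _ cS); last first.
    by move=> [r s] /= [rI sI]; split; apply: itv_conv.
  apply: continuous_subspaceT => z.
  exact: (continuous_pair_at (@interpolation_continuous _ dn up cdn cup z)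
    (@interpolation_continuous _ up dn cup cdn z)).
- by move=> r rI; rewrite /H /= !subr0 !subrr !mul1r !mul0r !addr0 !add0r.
- move=> s sI; rewrite /H /= up_0 dn_0 up_1 dn_1 !mulr0 !mulr1 addr0.
  by rewrite subrK.
Qed.

Lemma class_mul_reverse (a : R -> Ob G) (ca : {within I01, continuous a})
    (cr : {within I01, continuous (fun r => a (1 - r))}) :
  class_mul (class_of_path ca) (class_of_path cr) = class_unit (a 1).
Proof.
(* The bottom of this square is the reversed path, its right side is [a], and its left side and top
   are constant at [a 1]. *)
pose S (z : R * R) := a (Num.max (1 - z.1) z.2).
have cS : {within I01 `*` I01, continuous S}.
  apply: (@within_continuous_comp_within _ _ _ _ I01
    (fun z : R * R => Num.max (1 - z.1) z.2) a) ca.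
    apply: continuous_subspaceT => z.
    apply: (@continuous_comp _ _ _ (fun z : R * R => (1 - z.1, z.2))
      (fun z => Num.max z.1 z.2)); last exact: max_continuous.
    apply: (@continuous_pair_at _ _ _ (fun z : R * R => 1 - z.1) snd);
      last exact: cvg_snd.
    by apply: (@cvgB _ _ _ (nbhs z)); [exact: cvg_cst | exact: cvg_fst].
  move=> [r s] /= [+ +]; rewrite !in_itv /= => /andP[r0 r1] /andP[s0 s1].
  by rewrite le_max s0 orbT /= ge_max s1 gerBl r0.
have cl (k l : R -> R) : continuous k -> continuous l ->
    (forall r, r \in `[0, 1] -> k r \in `[0, 1]) ->
    (forall r, r \in `[0, 1] -> l r \in `[0, 1]) ->
    {within I01, continuous (fun r => S (k r, l r))}.
  move=> ck cl kI lI.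
  apply: (@within_continuous_comp_within _ _ _ _ (I01 `*` I01)
    (fun r => (k r, l r)) S) cS.
    apply: continuous_subspaceT => r.
    by apply: continuous_pair_at; [exact: ck | exact: cl].
  by move=> r rI; split=> /=; [exact: kI | exact: lI].
have i0 : (0:R) \in `[0, 1] by rewrite bound_itvE.
have i1 : (1:R) \in `[0, 1] by rewrite bound_itvE.
have cid : continuous (id : R -> R) by move=> r; exact: cvg_id.
have ccst (k : R) : continuous (fun _ : R => k) by move=> r; exact: cvg_cst.
have := class_mul_square cS (cl _ _ cid (ccst 0) (fun _ => id) (fun _ _ => i0))
  (cl _ _ (ccst 1) cid (fun _ _ => i1) (fun _ => id))
  (cl _ _ (ccst 0) cid (fun _ _ => i0) (fun _ => id))
  (cl _ _ cid (ccst 1) (fun _ => id) (fun _ _ => i1)).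
set p2 := class_of_path _; set p1 := class_of_path _.
set p4 := class_of_path _; set p3 := class_of_path _.
(* The class of a path sees only its values on [0, 1]: a deformation independent of the stage joins
   two paths that agree there. *)
have eqS (k : R -> R * R) (b : R -> Ob G)
  (ck : {within I01, continuous (S \o k)})
    (cb : {within I01, continuous b}) :
        (forall r, r \in `[0, 1] -> S (k r) = b r) ->
    class_of_path ck = class_of_path cb.
  move=> kb; apply: (@path_deform _ _ _ _ (S \o k \o fst)).
  - exact: within_continuous_fst.
  - by move=> r rI /=; rewrite kb.
  - by [].
have -> : p1 = class_of_path cr.
  have E := eqS (fun r => (r, 0)) _
    (cl _ _ cid (ccst 0) (fun _ => id) (fun _ _ => i0)) cr.
  apply: E => r; rewrite in_itv /= => /andP[r0 r1].
  by rewrite /S /= max_l // subr_ge0.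
have -> : p2 = class_of_path ca.
  have E := eqS (fun r => (1, r)) _
    (cl _ _ (ccst 1) cid (fun _ _ => i1) (fun _ => id)) ca.
  apply: E => r; rewrite in_itv /= => /andP[r0 r1].
  by rewrite /S /= subrr max_r.
have -> : p3 = class_unit (a 1).
  have E := eqS (fun r => (0, r)) _
    (cl _ _ (ccst 0) cid (fun _ _ => i0) (fun _ => id))
    (@constant_path_continuous _ G (a 1)).
  apply: E => r; rewrite in_itv /= => /andP[r0 r1].
  by rewrite /S /= subr0 max_l.
have -> : p4 = class_unit (a 1).
  have E := eqS (fun r => (r, 1)) _
    (cl _ _ cid (ccst 1) (fun _ => id) (fun _ _ => i1))
    (@constant_path_continuous _ G (a 1)).
  apply: E => r; rewrite in_itv /= => /andP[r0 r1].
  by rewrite /S /= max_r // gerBl.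
by move=> ->; rewrite -{2}(class_src_path (@constant_path_continuous _ G (a 1)))
  class_mul1.
Qed.

End Squares.

(** * Strict homotopies *)

Section StrictHomotopy.
Context {R : realType} (K G : lie_groupoid R) (phi psi : morphism K G).
Let LK := lieP K.

Notation I01 := (`[0, 1]%classic : set R).

Context (H : Ob K -> path_class G)
  (H_src : forall x, class_src (H x) = fob phi x)
  (H_tgt : forall x, class_tgt (H x) = fob psi x)
  (H_path : forall (q : R -> Ob K), {within I01, continuous q} ->
  forall (c1 : {within I01, continuous (fob psi \o q)})
    (c2 : {within I01, continuous (fob phi \o q)}),
  class_mul (class_of_path c1) (H (q 0))
    = class_mul (H (q 1)) (class_of_path c2))
  (H_arrow : forall g,
  class_mul (arrow_class (far psi g)) (H (src g)) =
  class_mul (H (tgt g)) (arrow_class (far phi g))).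

Lemma natural_class_smooth : @smooth R (Ob K) (class_space G) H.
Proof.
move=> x _; have mK := ob_manifold LK.
have sphi : smooth (fob phi) := fob_smooth (morP phi).
have spsi : smooth (fob psi) := fob_smooth (morP psi).
have [c [cG [ac acG cx cGx [g1 [W1 [oW1 W1x sg1 W1P]]]]]] := sphi x I.
have [c2 [dG [ac2 adG c2x dGx [g2 [W2 [oW2 W2x sg2 W2P]]]]]] := spsi x I.
(* The local expressions of phi and psi may use different charts of K; [e] carries the coordinates
   in [c] to those in [c2]. *)
have [e [W3 [oW3 W3x se W3P]]] := chart_compatible mK ac ac2 cx c2x.
have [U UP] := contractible_nbhd_exists acG cGx.
have [V VP] := contractible_nbhd_exists adG dGx.
have [_ oU Ux _ _] := UP; have [_ oV Vx _ _] := VP.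
have xUV : nbhs x (fob phi @^-1` U `&` fob psi @^-1` V).
  apply: filterI.
    exact: (@continuous_fob _ _ _ phi x U (open_nbhs_nbhs (conj oU Ux))).
  exact: (@continuous_fob _ _ _ psi x V (open_nbhs_nbhs (conj oV Vx))).
have [B [oB Bx Bq]] := straight_path mK ac cx xUV.
have domH y : chart_dom c y -> B (c y) ->
    chart_dom (class_chart (H x) U V cG dG) (H y).
  move=> cy /(Bq _ cy)[q [cq q0 q1 qUV]].
  have cphi := within_continuous_postcomp cq (@continuous_fob _ _ _ phi).
  have cpsi := within_continuous_postcomp cq (@continuous_fob _ _ _ psi).
  (* [class_chart] wants a path from the source of H(y) to that of H(x), whence the reversal. *)
  have crev : {within I01, continuous (fun r => (fob phi \o q) (1 - r))}.
    apply: (@within_continuous_comp_within _ _ _ _ I01 (fun r : R => 1 - r)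
      (fob phi \o q)) cphi.
      apply: continuous_subspaceT => r.
      by apply: (@cvgB _ _ _ (nbhs r)); [exact: cvg_cst | exact: cvg_id].
    move=> r; rewrite /= !in_itv /= => /andP[r0 r1].
    by rewrite subr_ge0 r1 gerBl.
  exists (class_of_path crev), (class_of_path cpsi); split.
  - exists (fun r => (fob phi \o q) (1 - r)), crev; split=> //=.
    + by rewrite subr0 q1 H_src.
    + by rewrite subrr q0 H_src.
    + move=> r; rewrite in_itv /= => /andP[r0 r1].
      by have [] : (fob phi @^-1` U `&` fob psi @^-1` V) (q (1 - r));
        first by apply: qUV; rewrite in_itv /= subr_ge0 r1 gerBl.
  - exists (fob psi \o q), cpsi; split=> //=.
    + by rewrite q0 H_tgt.
    + by rewrite q1 H_tgt.
    + by move=> r /qUV[].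
  (* By naturality along [q], [psi q] H(x) [phi q]^-1 = H(y) [phi q] [phi q]^-1 = H(y). *)
  - have nat := H_path cq cpsi cphi; rewrite q0 q1 in nat.
    rewrite class_mulA; last 2 first.
    + by rewrite class_src_path /= q0 H_tgt.
    + by rewrite class_tgt_path /= subrr q0 H_src.
    rewrite nat -class_mulA; last 2 first.
    + by rewrite class_tgt_path /= q1 H_src.
    + by rewrite class_src_path class_tgt_path /= subrr.
    by rewrite class_mul_reverse /= q1 -H_src class_mul1.
exists c, (class_chart (H x) U V cG dG); split=> //.
- by exists (H x), U, V, cG, dG; rewrite H_src H_tgt.
- exact: domH.
exists (fun w => row_mx (g1 w) (g2 (e w))).
have We : nbhs (c x) (W3 `&` e @^-1` W2).
  apply: filterI; first by apply: open_nbhs_nbhs.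
  apply: (se 0%N (c x) W3x).
  have [_ <-] := W3P x I cx W3x.
  by apply: open_nbhs_nbhs.
(* [W1] and the interior make the two local expressions valid, and [B] provides the short paths; the
   interior supplies an open set and still contains [c x]. *)
exists (W1 `&` B `&` (W3 `&` e @^-1` W2)^°); split.
- by apply: openI; [exact: openI | exact: open_interior].
- by [].
- move=> k; apply: Ck_row_mx.
  + by apply: openI; [exact: openI | exact: open_interior].
  + by apply: Ck_subset (sg1 k) => w [[]].
  + apply: (@Ck_comp _ _ _ _ _ _ W2 e g2) => //.
    * by apply: openI; [exact: openI | exact: open_interior].
    * by move=> w [_ /interior_subset[]].
    * by apply: Ck_subset (se k) => w [_ /interior_subset[]].
- move=> y _ cy [[W1y By] /interior_subset[W3y W2y]]; split; first exact: domH.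
  have [_ ey] := W3P y I cy W3y; have [c2y _] := W3P y I cy W3y.
  rewrite /= H_src H_tgt; have [_ ->] := W1P y I cy W1y.
  by rewrite -ey; have [//|_ ->] := W2P y I c2y; rewrite ey.
Qed.

Lemma class_src_far (f : morphism K G) s :
  class_src (far (Defs.induced f) s) = fob f (class_src s).
Proof.
have [p [hp se]] := hclass_ex (erefl (class_src s)) (erefl (class_tgt s)).
by rewrite [in far _ _]se far_induced_hclass class_src_hclass.
Qed.

Lemma class_tgt_far (f : morphism K G) s :
  class_tgt (far (Defs.induced f) s) = fob f (class_tgt s).
Proof.
have [p [hp se]] := hclass_ex (erefl (class_src s)) (erefl (class_tgt s)).
by rewrite [in far _ _]se far_induced_hclass class_tgt_hclass.
Qed.

Lemma strict_homotopy_generators : strict_homotopy phi psi H.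
Proof.
split; [exact: natural_class_smooth|exact: H_src|exact: H_tgt|].
apply: class_ind => [g|q cq|r s rs IHr IHs].
(* The structure maps of [fundamental_groupoid] are unfolded to the operations on classes, for which
   the laws are stated. *)
- change (class_mul (far (Defs.induced psi) (arrow_class g))
  (H (class_src (arrow_class g)))
    = class_mul (H (class_tgt (arrow_class g)))
      (far (Defs.induced phi) (arrow_class g))).
  by rewrite !far_induced_arrow class_src_arrow class_tgt_arrow.
- change (class_mul (far (Defs.induced psi) (class_of_path cq))
  (H (class_src (class_of_path cq)))
    = class_mul (H (class_tgt (class_of_path cq)))
      (far (Defs.induced phi) (class_of_path cq))).
  rewrite (far_induced_path cq
    (within_continuous_postcomp cq (@continuous_fob _ _ _ psi))).
  rewrite (far_induced_path cq
    (within_continuous_postcomp cq (@continuous_fob _ _ _ phi))).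
  by rewrite class_src_path class_tgt_path; exact: H_path.
- change (class_mul (far (Defs.induced psi) r) (H (class_src r))
    = class_mul (H (class_tgt r)) (far (Defs.induced phi) r)) in IHr.
  change (class_mul (far (Defs.induced psi) s) (H (class_src s))
    = class_mul (H (class_tgt s)) (far (Defs.induced phi) s)) in IHs.
  change (class_mul (far (Defs.induced psi) (class_mul r s))
    (H (class_src (class_mul r s)))
    = class_mul (H (class_tgt (class_mul r s)))
      (far (Defs.induced phi) (class_mul r s))).
  (* Naturality is multiplicative: psi(r) psi(s) H = psi(r) H phi(s) = H phi(r) phi(s). *)
  rewrite !far_induced_mul // class_src_mul // class_tgt_mul //.
  rewrite -class_mulA ?class_src_far ?class_tgt_far ?H_src ?H_tgt ?rs //.
  rewrite IHs class_mulA ?class_src_far ?class_tgt_far ?H_src ?H_tgt ?rs //.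
  rewrite -rs IHr.
  by rewrite -class_mulA ?class_src_far ?class_tgt_far ?H_src ?H_tgt ?rs.
Qed.

End StrictHomotopy.

(** * Natural transformations and ordinary homotopies *)

Lemma nat_trans_strict_homotopy (R : realType) (K G : lie_groupoid R)
    (phi psi : morphism K G) (T : Ob K -> Ar G) : nat_trans phi psi T ->
  strict_homotopy phi psi (fun x => arrow_class (T x)).
Proof.
case=> sT T_src T_tgt T_comm.
have cT : continuous T := smooth_continuous (ob_manifold (lieP K)) sT.
apply: strict_homotopy_generators => [x|x|q cq c1 c2|g].
- by rewrite class_src_arrow T_src.
- by rewrite class_tgt_arrow T_tgt.
- have ch := within_continuous_postcomp cq cT.
  (* [T \o q] is a path of arrows whose sources trace phi q and whose targets trace psi q. *)
  have Es : fob phi \o q = @src R G \o (T \o q).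
    by apply/funext => r /=; rewrite T_src.
  have Et : fob psi \o q = @tgt R G \o (T \o q).
    by apply/funext => r /=; rewrite T_tgt.
  have cs := within_continuous_postcomp ch (@continuous_src _ G).
  have ct := within_continuous_postcomp ch (@continuous_tgt _ G).
  rewrite (class_of_path_eq c1 ct Et) (class_of_path_eq c2 cs Es).
  exact: class_mul_path_arrow.
- rewrite !arrow_class_mul ?T_comm ?T_src ?T_tgt //.
  + by rewrite (tgt_far (morP phi)).
  + by rewrite (src_far (morP psi)).
Qed.

Lemma ordinary_strict_homotopy (R : realType) (K G : lie_groupoid R)
    (phi psi : morphism K G)
    (F : morphism (prod_groupoid K (unit_groupoid interval_space)) G) :
  ordinary_homotopy phi psi F -> exists H, strict_homotopy phi psi H.
Proof.
case=> ob0 ar0 ob1 ar1; have [sob sar Fs Ft _ _] := morP F.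
have clamp0 : clamp 0 = time0 R by apply: val_inj; rewrite /= min_l ?max_l.
have clamp1 : clamp 1 = time1 R by apply: val_inj; rewrite /= min_l ?max_r.
have mK := ob_manifold (lieP K); have mA := ar_manifold (lieP K).
have cFar g : {within `[0, 1]%classic : set R,
    continuous (fun s => far F (g, clamp s))}.
  apply: continuous_subspaceT => s.
  by apply: (@smooth_cylinder_cvg _ _ _ _ _ (nbhs s) _ (fun=> g) id g s mA sar);
    [exact: cvg_cst | exact: cvg_id].
have cFob x : {within `[0, 1]%classic : set R,
    continuous (fun s => fob F (x, clamp s))}.
  apply: continuous_subspaceT => s.
  by apply: (@smooth_cylinder_cvg _ _ _ _ _ (nbhs s) _ (fun=> x) id x s mK sob);
    [exact: cvg_cst | exact: cvg_id].
exists (fun x => class_of_path (cFob x)).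
apply: strict_homotopy_generators => [x|x|q cq c1 c2|g].
- by rewrite class_src_path clamp0 ob0.
- by rewrite class_tgt_path clamp1 ob1.
(* Bottom and top of this square are phi q and psi q; its left and right sides represent H(q(0)) and
   H(q(1)). *)
- pose S (z : R * R) := fob F (q z.1, clamp z.2).
  have cS : {within `[0, 1]%classic `*` `[0, 1]%classic, continuous S}.
    apply/subspace_continuousP => -[r s] [rI sI].
    apply: (@smooth_cylinder_cvg _ _ _ _ _ _ _ (q \o fst) snd (q r) s mK sob).
      have cqf : {within `[0, 1]%classic `*` (`[0, 1]%classic : set R),
          continuous (q \o fst)} by exact: within_continuous_fst.
      by move/subspace_continuousP : cqf => /(_ (r, s)); apply.
    by apply: cvg_within_filter; exact: cvg_snd.
  have e1 : (fun r => S (r, 0)) = fob phi \o q.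
    by apply/funext => r; rewrite /S /= clamp0 ob0.
  have e4 : (fun r => S (r, 1)) = fob psi \o q.
    by apply/funext => r; rewrite /S /= clamp1 ob1.
  have d1 : {within `[0, 1]%classic : set R, continuous (fun r => S (r, 0))} by
    rewrite e1.
  have d4 : {within `[0, 1]%classic : set R, continuous (fun r => S (r, 1))} by
    rewrite e4.
  rewrite -(class_of_path_eq d1 c2 e1) -(class_of_path_eq d4 c1 e4).
  exact/esym/(class_mul_square cS).
- have h0 : far phi g = far F (g, clamp 0) by rewrite clamp0 ar0.
  have h1 : far psi g = far F (g, clamp 1) by rewrite clamp1 ar1.
  rewrite h0 h1.
  (* The homotopy carries [g] through a path of arrows from phi(g) to psi(g); its source and target
     paths represent H at the ends of [g]. *)
  have Es : (fun s => fob F (src g, clamp s))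
    = @src R G \o (fun s => far F (g, clamp s)).
    by apply/funext => s /=; rewrite Fs.
  have Et : (fun s => fob F (tgt g, clamp s))
    = @tgt R G \o (fun s => far F (g, clamp s)).
    by apply/funext => s /=; rewrite Ft.
  have cs := within_continuous_postcomp (cFar g) (@continuous_src _ G).
  have ct := within_continuous_postcomp (cFar g) (@continuous_tgt _ G).
  rewrite (class_of_path_eq (cFob (src g)) cs Es)
    (class_of_path_eq (cFob (tgt g)) ct Et).
  by rewrite (class_mul_path_arrow cs ct).
Qed.

Theorem proposition3p7 (R : realType) (K G : lie_groupoid R)
    (phi psi : morphism K G) :
  (forall T : Ob K -> Ar G, nat_trans phi psi T ->
     exists H, strict_homotopy phi psi H) /\
  (forall F : morphism (prod_groupoid K (unit_groupoid interval_space)) G,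
     ordinary_homotopy phi psi F ->
     exists H, strict_homotopy phi psi H).
Proof.
split=> [T /nat_trans_strict_homotopy hT|F];
  last exact: ordinary_strict_homotopy.
by eexists; exact: hT.
Qed.
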